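(* Let $(X,\mathcal{B},\mu)$ be a probability space, let $(T_1,\ldots,T_l)$ be a totally ergodic generating set of commuting invertible measure preserving transformations of $X$, and let $p_{ij}\colon\mathbb{Z}^d\to\mathbb{Z}$, $1\le i\le r$, $1\le j\le l$, be polynomials. Then for any $f_1,\ldots,f_r\in L^\infty(\mu)$ and any Følner sequence $\{\Phi_N\}_{N=1}^\infty$ in $\mathbb{Z}^d$, the averages $$\frac{1}{|\Phi_N|}\sum_{u\in\Phi_N}\prod_{i=1}^r f_i\bigl(T_1^{p_{i1}(u)}\cdots T_l^{p_{il}(u)}x\bigr)$$ converge in $L^2(\mu)$ as $N\to\infty$.
   Context: Commuting invertible measure preserving transformations $T_1,\ldots,T_l$ of $(X,\mathcal{B},\mu)$ form a totally ergodic generating set $(T_1,\ldots,T_l)$ if $T_1^{c_1}T_2^{c_2}\cdots T_l^{c_l}$ is ergodic for every $(c_1,\ldots,c_l)\in\mathbb{Z}^l\setminus\{(0,\ldots,0)\}$. A Følner sequence in $\mathbb{Z}^d$ is a sequence $\{\Phi_N\}_{N=1}^\infty$ of finite (nonempty) subsets of $\mathbb{Z}^d$ such that $\lim_{N\to\infty}|(g+\Phi_N)\,\Delta\,\Phi_N|/|\Phi_N|=0$ for every $g\in\mathbb{Z}^d$, where $\Delta$ is symmetric difference. Functions are taken real valued. *)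

(* Defs.v *)
From HB Require Import structures.
From mathcomp Require Import all_boot all_order all_algebra finmap.
From mathcomp Require mpoly.
From mathcomp Require Import all_classical all_reals all_analysis.

Set Implicit Arguments.
Unset Strict Implicit.
Unset Printing Implicit Defensive.

Import Order.TTheory GRing.Theory Num.Theory.
Import numFieldNormedType.Exports.

Local Open Scope classical_set_scope.
Local Open Scope ring_scope.

Record invertible_mpt (d : measure_display) (X : measurableType d)
    (R : realType) (mu : probability X R) := InvertibleMpt {
  mpt_fun :> X -> X ;
  mpt_inv : X -> X ;
  mpt_funK : cancel mpt_fun mpt_inv ;
  mpt_invK : cancel mpt_inv mpt_fun ;
  measurable_mpt_fun : measurable_fun [set: X] mpt_fun ;
  measurable_mpt_inv : measurable_fun [set: X] mpt_inv ;
  mpt_preserving : forall A : set X, measurable A ->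
    mu (mpt_fun @^-1` A) = mu A
}.

Section total_ergodicity.
Context (d : measure_display) (X : measurableType d) (R : realType).
Context (mu : probability X R).

Definition mpt_pow (T : invertible_mpt mu) (n : int) : X -> X :=
  match n with
  | Posz k => iter k T
  | Negz k => iter k.+1 (mpt_inv T)
  end.

Definition multi_pow (l : nat) (T : 'I_l -> invertible_mpt mu)
    (c : 'rV[int]_l) : X -> X :=
  \big[comp/id]_(j < l) mpt_pow (T j) (c ord0 j).

Definition ergodic (S : X -> X) : Prop :=
  forall A : set X, measurable A -> S @^-1` A = A ->
    mu A = 0%E \/ mu A = 1%E.

Definition totally_ergodic_generating_set (l : nat)
    (T : 'I_l -> invertible_mpt mu) : Prop :=
  (forall i j : 'I_l, T i \o T j = T j \o T i) /\
  (forall c : 'rV[int]_l, c != 0 -> ergodic (multi_pow T c)).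

Definition polynomial_average (l r m : nat) (T : 'I_l -> invertible_mpt mu)
    (p : 'I_r -> 'I_l -> 'rV[int]_m -> int) (f : 'I_r -> X -> R)
    (F : {fset 'rV[int]_m}) (x : X) : R :=
  (#|` F|%fset%:R)^-1 *
  \sum_(u <- F) \prod_(i < r) f i (multi_pow T (\row_(j < l) p i j u) x).

Definition converges_in_L2 (g : nat -> X -> R) : Prop :=
  exists2 h : X -> R, h \in Lfun mu 2%:E &
    ('N[mu]_2%:E[EFin \o (g N \- h)%R])%E @[N --> \oo] --> 0%E.

End total_ergodicity.

(* Integer-valued polynomials may have non-integer (necessarily rational)
   coefficients, e.g. n (n - 1) / 2. *)
Definition integer_polynomial (m : nat) (p : 'rV[int]_m -> int) : Prop :=
  exists q : mpoly.mpoly m rat, forall u : 'rV[int]_m,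
    (p u)%:~R = mpoly.meval (fun k : 'I_m => (u ord0 k)%:~R) q.

Definition folner (R : realType) (m : nat) (Phi : nat -> {fset 'rV[int]_m})
    : Prop :=
  (forall N : nat, Phi N != fset0) /\
  (forall g : 'rV[int]_m,
     let gPhi N := [fset (g + u)%R | u in Phi N]%fset in
     (#|` (gPhi N `\` Phi N) `|` (Phi N `\` gPhi N)|%fset%:R
        / #|` Phi N|%fset%:R : R) @[N --> \oo] --> (0 : R)).

(* Main.v *)
Require Import Defs.
From mathcomp Require Import all_boot all_order all_algebra finmap.
From mathcomp Require mpoly.
From mathcomp Require Import all_classical all_reals all_analysis.
From mathcomp Require Import measurable_realfun ess_sup_inf ring lra zify.

Set Implicit Arguments.
Unset Strict Implicit.
Unset Printing Implicit Defensive.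

Import Order.TTheory GRing.Theory Num.Theory.
Import numFieldNormedType.Exports.

Local Open Scope classical_set_scope.
Local Open Scope ring_scope.

(* Walsh's argument, carried out qualitatively over "mean spaces", that is
   algebras of bounded functions with a positive normalised linear functional.
   Fix all functions but the last one, [f],
   whose polynomial is [p]. Among all extensions of the space and all functions
   [w] there whose averages converge, choose one almost minimising the L2
   distance to [f], and put [u = f - w]. If the averages [h_k] of [u] along
   some [N_k] do not become small, then [u] correlates with the dual functions
   [E_(v in Phi_(N_k)) T^(- p v) (h_k * ...)]. By the Folner property, the
   averages of these dual functions on the space of sequences, with mean the
   ultralimit over [k], are themselves averages over [m] of the averages of the
   system consisting of the [q n] and the [q (n + m) + p n - p (n + m)], which
   converge by induction. So a multiple of the dual function improves [w], a
   contradiction. The polynomials obtained for the various [m] form a single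
   system with values in the group of [m]-dependent group elements, so no
   uniformity in [m] has to be tracked. The induction terminates because
   [q (n + m) + p n - p (n + m)] differs from [q n] by a finite difference of
   [q - p]: eliminating [p] preserves the classes of polynomials modulo lower
   degree other than the one of [p]. *)

(** * Averages over finite sets *)

Section averages.
Context {R : realType} {V : choiceType}.
Implicit Types (F : {fset V}) (h : V -> R).

Definition avg F h : R := (#|` F|%fset%:R)^-1 * \sum_(u <- F) h u.

Lemma avgD F h1 h2 : avg F (fun u => h1 u + h2 u) = avg F h1 + avg F h2.
Proof. by rewrite /avg big_split /= mulrDr. Qed.

Lemma avgZ F c h : avg F (fun u => c * h u) = c * avg F h.
Proof. by rewrite /avg -mulr_sumr mulrCA. Qed.

Lemma avgB F h1 h2 : avg F (fun u => h1 u - h2 u) = avg F h1 - avg F h2.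
Proof. by rewrite /avg sumrB mulrBr. Qed.

Lemma ler_avg F h1 h2 : (forall u, u \in F -> h1 u <= h2 u) ->
  avg F h1 <= avg F h2.
Proof.
by move=> h12; rewrite ler_wpM2l ?invr_ge0// big_seq [leRHS]big_seq ler_sum.
Qed.

Lemma avg_cst F c : F != fset0 -> avg F (fun=> c) = c.
Proof.
move=> F0; rewrite /avg big_const_seq count_predT iter_addr_0 -[c *+ _]mulr_natl.
by rewrite mulrA mulVf ?mul1r// pnatr_eq0 cardfs_eq0.
Qed.

Lemma eq_avg F h1 h2 : h1 =1 h2 -> avg F h1 = avg F h2.
Proof. by move=> /funext ->. Qed.

Lemma avg_bound F h B : F != fset0 -> (forall u, u \in F -> `|h u| <= B) ->
  `|avg F h| <= B.
Proof.
move=> F0 hB; rewrite ler_norml -{1}(avg_cst (- B) F0) -{2}(avg_cst B F0).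
by apply/andP; split; apply: ler_avg => u /hB;
   rewrite ler_norml => /andP[].
Qed.

(** The difference of the two sides is the variance of [h] over [F]. *)
Lemma sqr_avg_le F h : F != fset0 -> avg F h ^+ 2 <= avg F (fun u => h u ^+ 2).
Proof.
move=> F0; rewrite -subr_ge0; set a := avg F h.
have -> : avg F (fun u => h u ^+ 2) - a ^+ 2 = avg F (fun u => (h u - a) ^+ 2).
  rewrite [in RHS](_ : (fun u => _) =
    (fun u => h u ^+ 2 - (2 * a) * h u + a ^+ 2)); last first.
    by apply/funext => u; ring.
  by rewrite avgD avgB avgZ avg_cst// -/a; ring.
by rewrite -(avg_cst 0 F0); apply: ler_avg => u _; exact: sqr_ge0.
Qed.

Lemma exchange_avg F1 F2 (h : V -> V -> R) :
  avg F1 (fun u => avg F2 (h u)) = avg F2 (fun v => avg F1 (h^~ v)).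
Proof.
rewrite /avg -!mulr_sumr exchange_big/= mulrCA; congr *%R.
Qed.

End averages.

(** * Mean spaces and their L2 distance *)

(** The mean is asked to be finitely additive only, so that ultralimits of averages qualify
    alongside integrals. *)
Record mean_space (R : realType) := MeanSpace {
  pt :> Type ;
  alg : set (pt -> R) ;
  mean : (pt -> R) -> R ;
  alg_cst : forall c : R, alg (fun=> c) ;
  algD : forall f g, alg f -> alg g -> alg (fun x => f x + g x) ;
  algM : forall f g, alg f -> alg g -> alg (fun x => f x * g x) ;
  alg_bounded : forall f, alg f -> exists B : R, forall x, `|f x| <= B ;
  meanD : forall f g, alg f -> alg g ->
    mean (fun x => f x + g x) = mean f + mean g ;
  meanZ : forall c f, alg f -> mean (fun x => c * f x) = c * mean f ;
  mean_ge0 : forall f, alg f -> (forall x, 0 <= f x) -> 0 <= mean f ;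
  mean1 : mean (fun=> 1) = 1 }.

Arguments alg {R} _ _.
Arguments mean {R} _ _.

Section mean_space_theory.
Context {R : realType} (X : mean_space R).
Implicit Types f g : X -> R.

Lemma algZ c f : alg X f -> alg X (fun x => c * f x).
Proof. by move=> Xf; apply: algM => //; exact: alg_cst. Qed.

Lemma algB f g : alg X f -> alg X g -> alg X (fun x => f x - g x).
Proof.
move=> Xf Xg; rewrite (_ : (fun x => _) = (fun x => f x + (-1) * g x)).
  exact/algD/algZ.
by apply/funext => x; rewrite mulN1r.
Qed.

Lemma alg_sqr f : alg X f -> alg X (fun x => f x ^+ 2).
Proof. by move=> Xf; apply: (algM Xf Xf). Qed.

Lemma alg_sum (I : Type) (r : seq I) (F : I -> X -> R) :
  (forall i, alg X (F i)) -> alg X (fun x => \sum_(i <- r) F i x).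
Proof.
move=> XF; elim: r => [|i r IH].
  by under eq_fun do rewrite big_nil; exact: alg_cst.
by under eq_fun do rewrite big_cons; exact: algD.
Qed.

Lemma alg_avg (V : choiceType) (r : {fset V}) (F : V -> X -> R) :
  (forall i, alg X (F i)) -> alg X (fun x => avg r (F^~ x)).
Proof. by move=> XF; apply/algZ/alg_sum. Qed.

Lemma meanB f g : alg X f -> alg X g ->
  mean X (fun x => f x - g x) = mean X f - mean X g.
Proof.
move=> Xf Xg; rewrite (_ : (fun x => _) = (fun x => f x + (-1) * g x)).
  by rewrite meanD ?meanZ ?mulN1r//; exact: algZ.
by apply/funext => x; rewrite mulN1r.
Qed.

Lemma mean_cst c : mean X (fun=> c) = c.
Proof.
rewrite (_ : (fun=> c) = (fun x : X => c * (fun=> 1) x)); last first.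
  by apply/funext => x; rewrite mulr1.
by rewrite meanZ ?mean1 ?mulr1//; exact: alg_cst.
Qed.

Lemma ler_mean f g : alg X f -> alg X g -> (forall x, f x <= g x) ->
  mean X f <= mean X g.
Proof.
move=> Xf Xg fg; rewrite -subr_ge0 -meanB//.
by apply: mean_ge0 => [|x]; [exact: algB|rewrite subr_ge0].
Qed.

Lemma mean_bound f B : alg X f -> (forall x, `|f x| <= B) -> `|mean X f| <= B.
Proof.
move=> Xf fB; rewrite ler_norml -{1}(mean_cst (- B)) -{2}(mean_cst B).
by apply/andP; split; apply: ler_mean => //; (try exact: alg_cst) => x;
   have := fB x; rewrite ler_norml => /andP[].
Qed.

Lemma mean_sum (I : Type) (r : seq I) (F : I -> X -> R) :
  (forall i, alg X (F i)) ->
  mean X (fun x => \sum_(i <- r) F i x) = \sum_(i <- r) mean X (F i).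
Proof.
move=> XF; elim: r => [|i r IH].
  by under eq_fun do rewrite big_nil; rewrite mean_cst big_nil.
by under eq_fun do rewrite big_cons; rewrite meanD ?IH ?big_cons//; exact: alg_sum.
Qed.

Lemma mean_avg (V : choiceType) (r : {fset V}) (F : V -> X -> R) :
  (forall i, alg X (F i)) ->
  mean X (fun x => avg r (F^~ x)) = avg r (fun i => mean X (F i)).
Proof. by move=> XF; rewrite meanZ ?mean_sum//; exact: alg_sum. Qed.

(** Mean spaces may be incomplete, so convergence is expressed by the Cauchy property, with the
    squared distance in place of a norm. *)
Definition l2_cauchy (a : nat -> X -> R) := forall e : R, 0 < e ->
  exists N0, forall N M, (N0 <= N)%N -> (N0 <= M)%N ->
    mean X (fun x => (a N x - a M x) ^+ 2) <= e.

Lemma l2_cauchyD a b : (forall N, alg X (a N)) -> (forall N, alg X (b N)) ->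
  l2_cauchy a -> l2_cauchy b -> l2_cauchy (fun N x => a N x + b N x).
Proof.
move=> Xa Xb ca cb e e0; have e40 : 0 < e / 4 by rewrite divr_gt0.
have [[N1 H1] [N2 H2]] := (ca _ e40, cb _ e40).
exists (maxn N1 N2) => N M; rewrite !geq_max => /andP[N1N N2N] /andP[N1M N2M].
apply: (@le_trans _ _ (mean X (fun x =>
    2 * (a N x - a M x) ^+ 2 + 2 * (b N x - b M x) ^+ 2))).
  apply: ler_mean => [||x].
  - by apply/alg_sqr/algB; exact: algD.
  - by apply: algD; apply/algZ/alg_sqr/algB.
  - by have := sqr_ge0 (a N x - a M x - (b N x - b M x)); nra.
have aN : alg X (fun x => (a N x - a M x) ^+ 2) by exact/alg_sqr/algB.
have bN : alg X (fun x => (b N x - b M x) ^+ 2) by exact/alg_sqr/algB.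
rewrite meanD ?meanZ//; try exact: algZ.
by have := H1 N M N1N N1M; have := H2 N M N2N N2M; lra.
Qed.

Lemma l2_cauchyM (f : X -> R) a : alg X f -> (forall N, alg X (a N)) ->
  l2_cauchy a -> l2_cauchy (fun N x => f x * a N x).
Proof.
move=> Xf Xa ca e e0; have [B fB] := alg_bounded Xf.
(* Adding 1 to [B ^+ 2] keeps the divisor positive. *)
have eB0 : 0 < e / (1 + B ^+ 2) by rewrite divr_gt0// ltr_pwDl// sqr_ge0.
have [N0 H] := ca _ eB0.
exists N0 => N M NN MN; have := H N M NN MN.
have aN : alg X (fun x => (a N x - a M x) ^+ 2) by exact/alg_sqr/algB.
rewrite ler_pdivlMr ?ltr_pwDl ?sqr_ge0// mulrC -meanZ// => /(le_trans _); apply.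
apply: ler_mean => [||x].
- by apply/alg_sqr/algB; exact: algM.
- exact: algZ.
rewrite -mulrBr exprMn ler_wpM2r ?sqr_ge0// -[f x ^+ 2]real_normK ?num_real//.
rewrite -[B ^+ 2]mul1r; have := fB x; have := normr_ge0 (f x); nra.
Qed.

End mean_space_theory.

(** * Ultralimits and product spaces *)

Definition bounded_family {R : realType} {I : Type} (a : I -> R) :=
  exists B : R, forall i, `|a i| <= B.

(** This is the limit along an ultrafilter finer than [\oo], which exists for bounded sequences by
    compactness of a segment. Monotonicity tolerates finitely many exceptions. *)
Lemma exists_generalized_limit (R : realType) : exists L : (nat -> R) -> R,
  [/\ forall a b, bounded_family a -> bounded_family b ->
        L (fun k => a k + b k) = L a + L b,
      forall c a, bounded_family a -> L (fun k => c * a k) = c * L a,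
      L (fun=> 1) = 1 &
      forall a b k0, bounded_family a -> bounded_family b ->
        (forall k, (k0 <= k)%N -> a k <= b k) -> L a <= L b].
Proof.
have [U [UU subU]] := @ultraFilterLemma nat \oo%classic _.
have FU : ProperFilter U by exact: ultra_proper.
have cvgU (a : nat -> R) : bounded_family a -> cvg (a @ U).
  move=> [B aB]; have [|x [_ clx]] := @segment_compact R (- B) B (a @ U) _.
    by rewrite /=; apply: filterE => k /=; rewrite in_itv/= -ler_norml.
  apply/cvg_ex; exists x => A Ax.
  have [//|UnA] := @in_ultra_setVsetC _ U (a @^-1` A) UU.
  by have [y []] := clx (~` A) A UnA Ax.
exists (fun a => lim (a @ U)); split.
- by move=> a b /cvgU ca /cvgU cb; apply/cvg_lim => //; exact: cvgD.
- move=> c a /cvgU ca; apply/cvg_lim => //; apply: cvgM => //; exact: cvg_cst.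
- by apply/cvg_lim => //; exact: cvg_cst.
- move=> a b k0 /cvgU ca /cvgU cb ab; apply: ler_lim => //.
  by apply: subU; exists k0 => // k /= /ab.
Qed.

Section product_space.
Context {R : realType} (X J : mean_space R).
Hypothesis J_full : forall a : J -> R, bounded_family a -> alg J a.

(** The fibres are tied together only by a common bound. Since [J] carries all bounded functions,
    the fibre means can always be averaged again, and a bounded family of functions on [X] becomes
    one function. *)
Let prod_alg : set (X * J -> R) := fun f =>
  bounded_family f /\ forall j, alg X (fun x => f (x, j)).

Let prod_mean (f : X * J -> R) := mean J (fun j => mean X (fun x => f (x, j))).

Let prod_alg_mean f : prod_alg f -> alg J (fun j => mean X (fun x => f (x, j))).
Proof.
move=> [[B fB] Xf]; apply: J_full; exists B => j.
by apply: mean_bound => // x; exact: fB.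
Qed.

Lemma bounded_familyD (I : Type) (a b : I -> R) :
  bounded_family a -> bounded_family b -> bounded_family (fun i => a i + b i).
Proof.
move=> [A aA] [B bB]; exists (A + B) => i.
by rewrite (le_trans (ler_normD _ _))// lerD.
Qed.

Lemma bounded_familyM (I : Type) (a b : I -> R) :
  bounded_family a -> bounded_family b -> bounded_family (fun i => a i * b i).
Proof.
move=> [A aA] [B bB]; exists (A * B) => i.
by rewrite normrM ler_pM.
Qed.

Definition prod_space : mean_space R.
Proof.
refine (@MeanSpace R (X * J)%type prod_alg prod_mean _ _ _ _ _ _ _ _).
- by move=> c; split=> [|j]; [exists `|c| | exact: alg_cst].
- move=> f g [bf Xf] [bg Xg]; split=> [|j]; first exact: bounded_familyD.
  exact: algD.
- move=> f g [bf Xf] [bg Xg]; split=> [|j]; first exact: bounded_familyM.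
  exact: algM.
- by move=> f [].
- move=> f g Yf Yg; rewrite /prod_mean -meanD; try exact: prod_alg_mean.
  congr (mean J _); apply/funext => j; case: Yf Yg => _ Xf [_ Xg].
  by rewrite meanD.
- move=> c f Yf; rewrite /prod_mean -meanZ; last exact: prod_alg_mean.
  by congr (mean J _); apply/funext => j; case: Yf => _ Xf; rewrite meanZ.
- move=> f Yf f0; apply: mean_ge0 => [|j]; first exact: prod_alg_mean.
  by case: Yf => _ Xf; exact: mean_ge0.
- rewrite /prod_mean -[RHS](mean1 J); congr (mean J _).
  by apply/funext => j; rewrite mean1.
Defined.

Lemma bounded_fibre_mean f : alg prod_space f ->
  bounded_family (fun j => mean X (fun x => f (x, j))).
Proof.
move=> [[B fB] Xf]; exists B => j.
by apply: mean_bound => // x; exact: fB.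
Qed.

End product_space.

(** * Group actions on mean spaces *)

Record action {R : realType} (G : zmodType) (X : mean_space R) := Action {
  act :> G -> X -> X ;
  act0 : forall x, act 0 x = x ;
  actD : forall g h x, act (g + h) x = act g (act h x) ;
  act_alg : forall g f, alg X f -> alg X (fun x => f (act g x)) ;
  act_mean : forall g f, alg X f -> mean X (fun x => f (act g x)) = mean X f }.

(* The group [J -> G] of [J]-dependent group elements acts on [X * J]
   fibrewise, so that a family of systems on [X] is one system on [X * J]. *)
Definition fibre_action {R : realType} (G : zmodType) (X J : mean_space R)
    (J_full : forall a : J -> R, bounded_family a -> alg J a)
    (T : action G X) : action ((J -> G)%type : zmodType) (prod_space X J_full).
Proof.
refine (@Action R ((J -> G)%type : zmodType) (prod_space X J_full)
  (fun g y => (T (g y.2) y.1, y.2)) _ _ _ _).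
- by move=> [x j] /=; rewrite act0.
- by move=> g h [x j] /=; rewrite actD.
- move=> g f [[B fB] Xf]; split=> [|j]; first by exists B => y; exact: fB.
  exact: (act_alg T (g j) (Xf j)).
- move=> g f [_ Xf]; congr (mean J _); apply/funext => j.
  exact: (act_mean T (g j) (Xf j)).
Defined.

(** The same group element moves every fibre, so the first projection makes this an extension of
    [T]; the dual functions live in it. *)
Definition const_action {R : realType} (G : zmodType) (X J : mean_space R)
    (J_full : forall a : J -> R, bounded_family a -> alg J a)
    (T : action G X) : action G (prod_space X J_full).
Proof.
refine (@Action R G (prod_space X J_full) (fun g y => (T g y.1, y.2)) _ _ _ _).
- by move=> [x j] /=; rewrite act0.
- by move=> g h [x j] /=; rewrite actD.
- move=> g f [[B fB] Xf]; split=> [|j]; first by exists B => y; exact: fB.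
  exact: (act_alg T g (Xf j)).
- move=> g f [_ Xf]; congr (mean J _); apply/funext => j.
  exact: (act_mean T g (Xf j)).
Defined.

(** * The index space of the pairs [(k, m)] *)

Section index_space.
Context {R : realType} {V : choiceType} (Psi : nat -> {fset V}).
Hypothesis Psi0 : forall k, Psi k != fset0.


(** [mn] stands for the ultralimit over [k] of the averages over [Psi k]. The last clause keeps what
    matters of this: an inequality between the averages may fail for finitely many [k]. *)
Definition index_spec (mn : (nat * V -> R) -> R) :=
 [/\ forall a b, bounded_family a -> bounded_family b ->
        mn (fun k => a k + b k) = mn a + mn b,
      forall c a, bounded_family a -> mn (fun k => c * a k) = c * mn a,
      mn (fun=> 1) = 1 &
      forall a b k0, bounded_family a -> bounded_family b ->
        (forall k, (k0 <= k)%N -> avg (Psi k) (fun m => a (k, m)) <=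
                                  avg (Psi k) (fun m => b (k, m))) ->
        mn a <= mn b].

Lemma exists_index_mean : exists mn, index_spec mn.
Proof.
have [L [LD LZ L1 Lle]] := exists_generalized_limit R.
have bavg (a : nat * V -> R) : bounded_family a ->
    bounded_family (fun k => avg (Psi k) (fun m => a (k, m))).
  by move=> [B aB]; exists B => k; apply: avg_bound.
exists (fun a => L (fun k => avg (Psi k) (fun m => a (k, m)))); split.
- move=> a b ba bb; rewrite -LD; try exact: bavg.
  by congr L; apply/funext => k; rewrite avgD.
- move=> c a ba; rewrite -LZ; last exact: bavg.
  by congr L; apply/funext => k; rewrite avgZ.
- by rewrite -[RHS]L1; congr L; apply/funext => k; rewrite avg_cst.
- by move=> a b k0 ba bb; apply: Lle; exact: bavg.
Qed.

Definition index_space mn (Hmn : index_spec mn) : mean_space R.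
Proof.
refine (@MeanSpace R (nat * V)%type (@bounded_family R _) mn
  _ _ _ _ _ _ _ _); case: Hmn => mD mZ m1 mle //.
- by move=> c; exists `|c|.
- by move=> f g; exact: bounded_familyD.
- by move=> f g; exact: bounded_familyM.
- move=> f bf f0; have -> : 0 = mn (fun=> 0 * 1).
    by rewrite (mZ 0 (fun=> 1)) ?mul0r//; exists `|1|.
  apply: (mle _ _ 0%N) => [||k _]; first by exists `|0 * 1|.
    exact: bf.
  by apply: ler_avg => m _; rewrite mul0r.
Defined.

End index_space.

(** * Multiple averages and the Følner property *)

Section multiple_averages.
Context {R : realType} {V : choiceType} {G : zmodType} {X : mean_space R}.
Context (T : action G X).
Implicit Types s : seq ((V -> G) * (X -> R)).

Definition sysprod s (u : V) (x : X) := \prod_(a <- s) a.2 (T (a.1 u) x).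

Definition sysavg (F : {fset V}) s (x : X) := avg F (fun u => sysprod s u x).

Lemma act_inj_cancel g x : T (- g) (T g x) = x.
Proof. by rewrite -actD addNr act0. Qed.

Lemma alg_sysprod s u : (forall a, a \in s -> alg X a.2) -> alg X (sysprod s u).
Proof.
rewrite /sysprod; elim: s => [|a s IH] As.
  by under eq_fun do rewrite big_nil; exact: alg_cst.
under eq_fun do rewrite big_cons.
apply: algM; first by apply/act_alg/As; rewrite mem_head.
by apply: IH => b bs; apply: As; rewrite in_cons bs orbT.
Qed.

Lemma sysprod_bounded s : (forall a, a \in s -> alg X a.2) ->
  exists2 C : R, 0 < C & forall u x, `|sysprod s u x| <= C.
Proof.
elim: s => [|a s IH] As.
  by exists 1 => // u x; rewrite /sysprod big_nil normr1.
have [|C C0 sC] := IH; first by move=> b bs; apply: As; rewrite in_cons bs orbT.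
have [B aB] := alg_bounded (As a (mem_head _ _)).
exists ((`|B| + 1) * C) => [|u x]; first by rewrite mulr_gt0// ltr_wpDl.
rewrite /sysprod big_cons normrM ler_pM//; last exact: sC.
by rewrite (le_trans (aB _))// (le_trans (ler_norm _))// lerDl.
Qed.

Lemma alg_sysavg F s : (forall a, a \in s -> alg X a.2) -> alg X (sysavg F s).
Proof. by move=> As; apply: alg_avg => u; exact: alg_sysprod. Qed.

Lemma perm_sysavg F s s' : perm_eq s s' -> sysavg F s = sysavg F s'.
Proof.
move=> ss'; apply/funext => x; apply: eq_avg => u.
by rewrite /sysprod (perm_big _ ss').
Qed.

End multiple_averages.

(** The Følner property in the form used: a shift hardly changes averages. The threshold is chosen
    before [h] and [B], so it serves all bounded functions at once, in particular families depending
    on a point of the space. *)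
Definition folner_avg {R : realType} {V : zmodType} (Phi : nat -> {fset V}) :=
  (forall N, Phi N != fset0) /\
  forall (g : V) (e : R), 0 < e -> exists N0, forall N, (N0 <= N)%N ->
    forall (h : V -> R) B, (forall u, `|h u| <= B) ->
      `|avg (Phi N) (fun u => h (g + u)) - avg (Phi N) h| <= e * B.

Lemma folner_avg_uniform {R : realType} {V : zmodType} (Phi : nat -> {fset V})
    (F : {fset V}) (e : R) : folner_avg (R := R) Phi -> 0 < e ->
  exists N0, forall g, g \in F -> forall N, (N0 <= N)%N ->
    forall (h : V -> R) B, (forall u, `|h u| <= B) ->
      `|avg (Phi N) (fun u => h (g + u)) - avg (Phi N) h| <= e * B.
Proof.
move=> [_ PhiF] e0; have [n nP] := choice (fun g => PhiF g e e0).
exists (\max_(g <- F) n g)%N => g gF N nN; apply: nP; apply: leq_trans nN.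
by apply: (@leq_bigmax_seq _ (enum_fset F) xpredT n g).
Qed.

(** * Extensions of systems *)

Section extension.
Context {R : realType} {V : choiceType} {G : zmodType}.

(** In the language of dynamics, [pi] is a factor map from [T'] to [T]. *)
Definition extension (X X' : mean_space R) (T : action G X) (T' : action G X')
    (pi : X' -> X) :=
  [/\ forall g x, pi (T' g x) = T g (pi x),
      forall f, alg X f -> alg X' (fun x => f (pi x)) &
      forall f, alg X f -> mean X' (fun x => f (pi x)) = mean X f].

Definition pullback (X X' : Type) (pi : X' -> X)
    (s : seq ((V -> G) * (X -> R))) : seq ((V -> G) * (X' -> R)) :=
  [seq (a.1, fun x => a.2 (pi x)) | a <- s].

Lemma pullback_comp (X X' X'' : Type) (pi : X' -> X) (pi' : X'' -> X') s :
  pullback (pi \o pi') s = pullback pi' (pullback pi s).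
Proof. by rewrite /pullback -map_comp. Qed.

Lemma sysprod_pullback (X X' : mean_space R) (T : action G X)
    (T' : action G X') (pi : X' -> X) s u x : extension T T' pi ->
  sysprod T' (pullback pi s) u x = sysprod T s u (pi x).
Proof.
by case=> piT _ _; rewrite /sysprod big_map; apply: eq_bigr => a _; rewrite /= piT.
Qed.

Lemma sysavg_pullback (X X' : mean_space R) (T : action G X)
    (T' : action G X') (pi : X' -> X) F s x : extension T T' pi ->
  sysavg T' F (pullback pi s) x = sysavg T F s (pi x).
Proof. by move=> ext; apply: eq_avg => u; exact: sysprod_pullback. Qed.

Lemma l2_cauchy_pullback (X X' : mean_space R) (T : action G X)
    (T' : action G X') (pi : X' -> X) (a : nat -> X -> R) : extension T T' pi ->
  (forall n, alg X (a n)) -> l2_cauchy a -> l2_cauchy (fun n x => a n (pi x)).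
Proof.
move=> [_ _ piM] Xa ca e e0; have [N0 N0P] := ca e e0; exists N0 => n m Nn Nm.
by rewrite (piM (fun x => (a n x - a m x) ^+ 2)) ?N0P//; exact/alg_sqr/algB.
Qed.

Lemma extension_id (X : mean_space R) (T : action G X) : extension T T id.
Proof. by split. Qed.

Lemma extension_comp (X X' X'' : mean_space R) (T : action G X)
    (T' : action G X') (T'' : action G X'') pi pi' :
  extension T T' pi -> extension T' T'' pi' -> extension T T'' (pi \o pi').
Proof.
move=> [p1 p2 p3] [q1 q2 q3]; split => [g x|f Xf|f Xf] /=.
- by rewrite q1 p1.
- exact: (q2 _ (p2 _ Xf)).
- by rewrite (q3 _ (p2 _ Xf)) p3.
Qed.

Lemma extension_fst (X J : mean_space R) (T : action G X)
    (J_full : forall a : J -> R, bounded_family a -> alg J a) :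
  extension T (const_action J_full T) fst.
Proof.
split => // f Xf.
  by split=> //=; have [B fB] := alg_bounded Xf; exists B => y; exact: fB.
exact: (mean_cst J (mean X f)).
Qed.

Lemma pullback_alg (X X' : mean_space R) (T : action G X) (T' : action G X') pi
    (s : seq ((V -> G) * (X -> R))) :
  extension T T' pi -> (forall a, a \in s -> alg X a.2) ->
  forall a, a \in pullback pi s -> alg X' a.2.
Proof. by move=> [_ piA _] As a /mapP[b /As Ab ->]; exact: piA. Qed.

End extension.

Section head_linearity.
Context {R : realType} {V : choiceType} {G : zmodType} {X : mean_space R}.
Context (T : action G X) (F : {fset V}) (p : V -> G).
Implicit Types (f g : X -> R) (s : seq ((V -> G) * (X -> R))).

Lemma sysavg_cons f s x : sysavg T F ((p, f) :: s) x =
  avg F (fun u => f (T (p u) x) * sysprod T s u x).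
Proof. by apply: eq_avg => u; rewrite /sysprod big_cons. Qed.

Lemma sysavg_consD f g s x : sysavg T F ((p, fun x => f x + g x) :: s) x =
  sysavg T F ((p, f) :: s) x + sysavg T F ((p, g) :: s) x.
Proof. by rewrite !sysavg_cons -avgD; apply: eq_avg => u; rewrite mulrDl. Qed.

Lemma sysavg_consZ c f s x : sysavg T F ((p, fun x => c * f x) :: s) x =
  c * sysavg T F ((p, f) :: s) x.
Proof. by rewrite !sysavg_cons -avgZ; apply: eq_avg => u; rewrite mulrA. Qed.

End head_linearity.

Definition lifted {G : zmodType} {V I : Type} (q : V -> G) (u : V) (i : I) := q u.

(* For [i = (k, m)] this is Walsh's [<p|q>_m] in additive notation. The index
   [k] is idle: it is there because the dual functions live on [X * (nat * V)]. *)
Definition derived {G V : zmodType} (p q : V -> G) (u : V) (i : nat * V) :=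
  q (u + i.2) + (p u - p (u + i.2)).

(** * Dual functions and their averages *)

Section convergence.
Context {R : realType} {V : zmodType} (Phi : nat -> {fset V}).
Hypothesis PhiF : folner_avg (R := R) Phi.

(** Space, action and functions are quantified here, so the property depends on [G] and [S] alone
    and can be applied on a product such as [X * (nat * V)]. *)
Definition convergent_systems (G : zmodType) (S : set (V -> G)) :=
  forall (X : mean_space R) (T : action G X) (s : seq ((V -> G) * (X -> R))),
    (forall a, a \in s -> S a.1 /\ alg X a.2) ->
    l2_cauchy (fun N => sysavg T (Phi N) s).

Section dual_functions.
Context (G : zmodType) (S : set (V -> G)) (p : V -> G).
Hypothesis IH : @convergent_systems ((nat * V -> G)%type : zmodType)
  [set q | (exists2 q0, S q0 & q = lifted q0) \/
           (exists2 q0, S q0 \/ q0 = (fun=> 0) & q = derived p q0)].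
Context (X : mean_space R) (T : action G X) (s : seq ((V -> G) * (X -> R))).
Hypothesis sS : forall a, a \in s -> S a.1 /\ alg X a.2.
Context (N : nat -> nat) (NN : forall k, (k <= N k)%N).
Context (h : nat -> X -> R) (Xh : forall k, alg X (h k)) (B : R).
Hypothesis (B0 : 0 < B) (hB : forall k x, `|h k x| <= B).
Context (mn : (nat * V -> R) -> R) (Hmn : index_spec (fun k => Phi (N k)) mn).

Let Psi0 k : Phi (N k) != fset0. Proof. by case: PhiF. Qed.

Let J := index_space Hmn.
Let Y := @prod_space R X J (fun a ba => ba).

(** When [h k] is the average at [N k] of [u] against [s], moving [T (p v)] to the other side turns
    the mean of [h k ^+ 2] into the pairing of [u] with this function. The coordinate [m] is idle
    here; it is the averaging variable for [Bavg]. *)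
Definition dual (y : X * (nat * V)) := avg (Phi (N y.2.1)) (fun v =>
  h y.2.1 (T (- p v) y.1) * sysprod T s v (T (- p v) y.1)).

Let As : forall a, a \in s -> alg X a.2. Proof. by move=> a /sS[]. Qed.

Lemma alg_dual_fibre k m : alg X (fun x => dual (x, (k, m))).
Proof.
have Xhs v : alg X (fun x => h k (T (- p v) x) * sysprod T s v (T (- p v) x)).
  apply: (act_alg T (- p v) (f := fun x => h k x * sysprod T s v x)).
  by apply: algM => //; exact: alg_sysprod.
exact: (alg_avg (Phi (N k)) Xhs).
Qed.

Lemma alg_dual : alg Y dual.
Proof.
have [C C0 sC] := sysprod_bounded T As.
split=> [|[k m]]; last exact: alg_dual_fibre.
exists (B * C) => -[x [k m]]; apply: avg_bound => // v _.
by rewrite normrM ler_pM.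
Qed.

Let Tc := @const_action R G X J (fun a ba => ba) T.
Let Tf := @fibre_action R G X J (fun a ba => ba) T.

Let phi l x k v := h k (T (p l - p v) x) * sysprod T s v (T (p l - p v) x).

Let Davg n k x := avg (Phi n) (fun l =>
  sysprod T s l x * avg (Phi (N k)) (phi l x k)).

(** With [v = l + m], the group elements in [phi l x k v] are [derived p (fun=> 0)] for [h] and
    [derived p q] for the members of [s], all evaluated at [l]. Thus [Bavg] is the average of one
    system for the fibrewise action, and [IH] applies to it. *)
Let sysY : seq ((V -> (nat * V -> G)) * (Y -> R)) :=
  [seq (lifted a.1, fun y : Y => a.2 y.1) | a <- s] ++
  (derived p (fun=> 0), fun y : Y => h y.2.1 y.1) ::
  [seq (derived p a.1, fun y : Y => a.2 y.1) | a <- s].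

Let Bavg n x k m := avg (Phi n) (fun l => sysprod T s l x * phi l x k (l + m)).

Let DavgE n y : sysavg Tc (Phi n) ((p, dual) :: pullback fst s) y = Davg n y.2.1 y.1.
Proof.
case: y => x [k m]; apply: eq_avg => l; rewrite /sysprod big_cons mulrC.
congr (_ * _).
  by rewrite -/(sysprod _ _ _ _) (sysprod_pullback _ _ _ (extension_fst T _)).
by apply: eq_avg => v /=; rewrite /phi -!actD ![- p v + _]addrC.
Qed.

Let BavgE n y : sysavg Tf (Phi n) sysY y = Bavg n y.1 y.2.1 y.2.2.
Proof.
case: y => x [k m]; apply: eq_avg => l; rewrite /sysprod big_cat big_cons !big_map /=.
congr (_ * (_ * _)); first by rewrite /derived/= add0r.
by apply: eq_bigr => a _; rewrite /derived/= actD.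
Qed.

Let sysY_ok a : a \in sysY ->
 ((exists2 q0, S q0 & a.1 = lifted q0) \/
  (exists2 q0, S q0 \/ q0 = (fun=> 0) & a.1 = derived p q0)) /\ alg Y a.2.
Proof.
have algfst b : b \in s -> alg Y (fun y : Y => b.2 y.1).
  by case: (extension_fst T (fun (a : J -> R) ba => ba)) => _ + _ => aX /As/aX.
rewrite mem_cat in_cons => /orP[/mapP[b bs ->]|/orP[/eqP ->|/mapP[b bs ->]]].
- by split; [left; exists b.1 => //; case: (sS bs)|exact: algfst].
- split; first by right; exists (fun=> 0) => //; right.
  by split=> [|[k m]]; [exists B => y; exact: hB|exact: Xh].
- by split; [right; exists b.1 => //; left; case: (sS bs)|exact: algfst].
Qed.

(** For fixed [n] the variable [l] runs through a finite set, so for large [k] the shift by [l] in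
    the average over [Phi (N k)] is negligible: [Davg n] is nearly the average over [m] of [Bavg n].
    By [sqr_avg_le] it inherits the Cauchy property of [Bavg]. *)
Lemma dual_cauchy : l2_cauchy (X := Y)
  (fun n => sysavg Tc (Phi n) ((p, dual) :: pullback fst s)).
Proof.
have [C C0 sC] := sysprod_bounded T As.
move=> e e0; have e40 : 0 < e / 4 by rewrite divr_gt0.
have [N0 N0P] := @IH Y Tf sysY sysY_ok _ e40.
exists N0 => n n' Nn Nn'; have {N0P}Bsmall := N0P n n' Nn Nn'.
(* Both averages are approximated within [t], so passing to [Bavg] costs [2 * (2 * t) ^+ 2], at most
   [e / 2]. *)
pose t := Num.min 1 (e / 16).
have t0 : 0 < t by rewrite lt_min ltr01 divr_gt0.
have te : 16 * t ^+ 2 <= e.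
  have t1 : t <= 1 by rewrite ge_min lexx.
  have t2 : t <= e / 16 by rewrite ge_min lexx orbT.
  by nra.
have BC0 : 0 < C * (B * C) by rewrite !mulr_gt0.
(* The Følner error gets multiplied by the bound [B * C] of [phi] and by the bound [C] of the outer
   product. *)
have [K KP] := folner_avg_uniform (e := t / (C * (B * C))) (Phi n `|` Phi n')%fset
  PhiF (divr_gt0 t0 BC0).
have phiB l x k v : `|phi l x k v| <= B * C by rewrite normrM ler_pM.
have {KP}close j k x : (K <= k)%N -> (j = n \/ j = n') ->
    `|Davg j k x - avg (Phi (N k)) (fun m => Bavg j x k m)| <= t.
  move=> Kk jn; rewrite /Bavg exchange_avg -avgB; apply: avg_bound => [|l lj].
    by case: PhiF.
  rewrite avgZ -mulrBr normrM distrC.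
  apply: (@le_trans _ _ (C * (t / (C * (B * C)) * (B * C)))); last first.
    by rewrite [leLHS](_ : _ = t)//; field; rewrite !gt_eqF.
  apply: ler_pM => //; apply: (KP l) => //; first last.
    exact: leq_trans Kk (NN k).
  by rewrite inE; case: jn => <-; rewrite lj ?orbT.
have YD j : alg Y (fun y => Davg j y.2.1 y.1).
  rewrite (_ : (fun y => _) = sysavg Tc (Phi j) ((p, dual) :: pullback fst s)).
    apply: alg_sysavg => a; rewrite inE => /orP[/eqP ->|]; first exact: alg_dual.
    exact: (pullback_alg (extension_fst T (fun (a : J -> R) ba => ba)) As).
  by apply/funext => y; rewrite DavgE.
have YB j : alg Y (fun y => Bavg j y.1 y.2.1 y.2.2).
  rewrite (_ : (fun y => _) = sysavg Tf (Phi j) sysY).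
    by apply: alg_sysavg => a /sysY_ok[].
  by apply/funext => y; rewrite BavgE.
have YDD : alg Y (fun y => (Davg n y.2.1 y.1 - Davg n' y.2.1 y.1) ^+ 2).
  exact/alg_sqr/algB.
have YBB : alg Y (fun y =>
    (Bavg n y.1 y.2.1 y.2.2 - Bavg n' y.1 y.2.1 y.2.2) ^+ 2).
  exact/alg_sqr/algB.
under eq_fun do rewrite !DavgE.
move: Bsmall; under eq_fun do rewrite !BavgE.
move=> Bsmall.
have YR : alg Y (fun y => e / 2 + 2 *
    (Bavg n y.1 y.2.1 y.2.2 - Bavg n' y.1 y.2.1 y.2.2) ^+ 2).
  by apply: algD; [exact: alg_cst|exact: algZ].
apply: (@le_trans _ _ (mean Y (fun y => e / 2 + 2 *
    (Bavg n y.1 y.2.1 y.2.2 - Bavg n' y.1 y.2.1 y.2.2) ^+ 2))); last first.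
  rewrite (meanD (alg_cst Y _) (algZ _ YBB)) mean_cst meanZ//.
  by move: Bsmall; lra.
(* The approximation holds for [k >= K] only, which suffices for [mn]. *)
case: (Hmn) => _ _ _ mle; apply: (mle _ _ K).
- exact: bounded_fibre_mean YDD.
- exact: bounded_fibre_mean YR.
move=> k Kk /=; rewrite avg_cst ?Psi0//.
rewrite -mean_avg => [|m]; last by case: YR => _ /(_ (k, m)).
apply: ler_mean => [||x].
- by case: YDD => _ /(_ (k, 0)).
- by apply: alg_avg => m; case: YR => _ /(_ (k, m)).
rewrite avgD avg_cst ?Psi0// avgZ.
have := sqr_avg_le (fun m => Bavg n x k m - Bavg n' x k m) (Psi0 k).
rewrite avgB.
have := close n k x Kk (or_introl erefl); have := close n' k x Kk (or_intror erefl).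
set a := avg _ _; set b := avg _ _; set c := avg _ _ => {close}.
move: (Davg n k x) (Davg n' k x) a b c => D D' a b c.
rewrite !ler_norml => /andP[a1 a2] /andP[b1 b2] bac.
have u1 : 0 <= 2 * t - (D - D' - (b - a)) by lra.
have u2 : 0 <= 2 * t + (D - D' - (b - a)) by lra.
have := mulr_ge0 u1 u2; have := sqr_ge0 (D - D' - 2 * (b - a)).
by move: bac te; nra.
Qed.



Section correlation.
Context (u : X -> R) (Xu : alg X u) (C : R).
Hypothesis hE : forall k x, h k x = sysavg T (Phi (N k)) ((p, u) :: s) x.
Hypothesis sC : forall v x, `|sysprod T s v x| <= C.

Let Xs v : alg X (sysprod T s v). Proof. exact: alg_sysprod. Qed.

Let Xhs k v : alg X (fun x => h k x * sysprod T s v x).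
Proof. by apply: algM. Qed.

Let Xhs_act k v :
  alg X (fun x => h k (T (- p v) x) * sysprod T s v (T (- p v) x)).
Proof. exact: (act_alg T (- p v) (Xhs k v)). Qed.

Let sqrC v x : sysprod T s v x ^+ 2 <= C ^+ 2.
Proof.
have := sC v x; rewrite -[X in _ -> X <= _]real_normK ?num_real//.
by have := normr_ge0 (sysprod T s v x); nra.
Qed.

(** Invariance under [T (p v)] produces [h k x] times [u (T (p v) x) * sysprod T s v x], and the
    average of the latter over [v] is again [h k x]. *)
Lemma mean_dual_fibre k m :
  mean X (fun x => u x * dual (x, (k, m))) = mean X (fun x => h k x ^+ 2).
Proof.
rewrite /dual /=; under eq_fun do rewrite -avgZ.
rewrite mean_avg => [|v]; last by apply: algM.
transitivity (avg (Phi (N k)) (fun v =>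
    mean X (fun x => h k x * (u (T (p v) x) * sysprod T s v x)))).
  apply: eq_avg => v; rewrite -(act_mean T (p v)); last by apply: algM.
  congr (mean X _); apply/funext => x; rewrite !act_inj_cancel.
  by rewrite mulrCA.
rewrite -mean_avg => [|v]; last first.
  by apply: algM => //; apply: algM => //; exact: act_alg.
congr (mean X _); apply/funext => x; rewrite avgZ expr2 {3}hE.
by rewrite sysavg_cons.
Qed.

Lemma mean_sqr_dual_fibre k m :
  mean X (fun x => dual (x, (k, m)) ^+ 2) <= C ^+ 2 * mean X (fun x => h k x ^+ 2).
Proof.
pose F v x := h k (T (- p v) x) * sysprod T s v (T (- p v) x).
apply: (@le_trans _ _ (mean X (fun x => avg (Phi (N k)) (fun v => F v x ^+ 2)))).
  apply: ler_mean => [||x]; first exact/alg_sqr/alg_dual_fibre.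
    by apply: alg_avg => v; exact/alg_sqr/Xhs_act.
  exact: sqr_avg_le.
rewrite mean_avg => [|v]; last exact/alg_sqr/Xhs_act.
rewrite -[leRHS](avg_cst _ (Psi0 k)); apply: ler_avg => v _.
rewrite (act_mean T (- p v) (alg_sqr (Xhs k v))) -meanZ; last exact: alg_sqr.
apply: ler_mean => [||x]; [exact: alg_sqr|exact/algZ/alg_sqr|].
by rewrite exprMn mulrC ler_wpM2r ?sqr_ge0.
Qed.

Lemma mean_sqr_head_le k :
  mean X (fun x => h k x ^+ 2) <= C ^+ 2 * mean X (fun x => u x ^+ 2).
Proof.
have XF v : alg X (fun x => u (T (p v) x)) by exact: act_alg.
apply: (@le_trans _ _ (mean X (fun x => avg (Phi (N k)) (fun v =>
    (u (T (p v) x) * sysprod T s v x) ^+ 2)))).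
  apply: ler_mean => [||x]; first exact/alg_sqr.
    by apply: alg_avg => v; apply/alg_sqr/algM.
  by rewrite hE sysavg_cons; exact: sqr_avg_le.
rewrite mean_avg => [|v]; last by apply/alg_sqr/algM.
rewrite -[leRHS](avg_cst _ (Psi0 k)); apply: ler_avg => v _.
rewrite -(act_mean T (p v) (alg_sqr Xu)) -meanZ; last exact: (alg_sqr (XF v)).
apply: ler_mean => [||x]; [by apply/alg_sqr/algM|exact/algZ/(alg_sqr (XF v))|].
by rewrite exprMn mulrC ler_wpM2r ?sqr_ge0.
Qed.

Lemma mean_dual eta : (forall k, eta <= mean X (fun x => h k x ^+ 2)) ->
  eta <= mean Y (fun y => u y.1 * dual y).
Proof.
move=> etah.
have Yu : alg Y (fun y => u y.1 * dual y).
  apply: algM; last exact: alg_dual.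
  by case: (extension_fst T (fun (a : J -> R) ba => ba)) => _ + _; apply.
rewrite -[leLHS](mean_cst J); case: (Hmn) => _ _ _ mle; apply: (mle _ _ 0%N).
- by exists `|eta|.
- exact: bounded_fibre_mean Yu.
- by move=> k _; apply: ler_avg => m _ /=; rewrite mean_dual_fibre.
Qed.

(** Averaging, invariance and the bound [C] on the products cost [C ^+ 2] twice: from the dual
    function to [h k], and from [h k] to [u]. The bound is in terms of the L2 norm because in
    [convergent_step] the supremum of [u] depends on the approximant. *)
Lemma mean_sqr_dual :
  mean Y (fun y => dual y ^+ 2) <= C ^+ 4 * mean X (fun x => u x ^+ 2).
Proof.
rewrite -[leRHS](mean_cst J); case: (Hmn) => _ _ _ mle; apply: (mle _ _ 0%N).
- exact: bounded_fibre_mean (alg_sqr alg_dual).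
- by eexists; move=> ?; exact: lexx.
- move=> k _; apply: ler_avg => m _ /=.
  apply: (le_trans (mean_sqr_dual_fibre k m)).
  rewrite (_ : C ^+ 4 = C ^+ 2 * C ^+ 2); last by ring.
  by rewrite -mulrA ler_wpM2l ?sqr_ge0// mean_sqr_head_le.
Qed.

End correlation.

End dual_functions.

(** The bad indices [n], one beyond each [k], form a sequence [N]; the ultralimit over [k] then
    combines all the corresponding dual functions into one function on one extension. *)
Lemma exists_dual (G : zmodType) (S : set (V -> G)) (p : V -> G) (X : mean_space R)
    (T : action G X) (s : seq ((V -> G) * (X -> R))) (u : X -> R) (C eta : R) :
  @convergent_systems ((nat * V -> G)%type : zmodType)
    [set q | (exists2 q0, S q0 & q = lifted q0) \/
             (exists2 q0, S q0 \/ q0 = (fun=> 0) & q = derived p q0)] ->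
  (forall a, a \in s -> S a.1 /\ alg X a.2) -> alg X u ->
  (forall v x, `|sysprod T s v x| <= C) ->
  (forall k, exists2 n, (k <= n)%N &
     eta <= mean X (fun x => sysavg T (Phi n) ((p, u) :: s) x ^+ 2)) ->
  exists (Y : mean_space R) (TY : action G Y) (pi : Y -> X) (g : Y -> R),
  [/\ extension T TY pi, alg Y g,
     l2_cauchy (fun n => sysavg TY (Phi n) ((p, g) :: pullback pi s)),
     eta <= mean Y (fun y => u (pi y) * g y) &
     mean Y (fun y => g y ^+ 2) <= C ^+ 4 * mean X (fun x => u x ^+ 2)].
Proof.
move=> IH sS Xu sC bad.
have {bad}[N NP] := choice (fun k => let: ex_intro2 n kn Hn := bad k in
  ex_intro (fun n => (k <= n)%N /\ eta <= mean X _) n (conj kn Hn)).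
pose h k := sysavg T (Phi (N k)) ((p, u) :: s).
have As (a : (V -> G) * (X -> R)) : a \in (p, u) :: s -> alg X a.2.
  by rewrite inE => /orP[/eqP -> //|/sS[]].
have [B B0 hB] := sysprod_bounded T As.
have Xh k : alg X (h k) by exact: alg_sysavg.
have Phi0 k : Phi (N k) != fset0 by case: PhiF.
have {}hB k x : `|h k x| <= B by exact: avg_bound.
have [mn Hmn] := @exists_index_mean R _ _ Phi0.
exists (prod_space X (fun (a : index_space Hmn -> R) ba => ba)).
exists (const_action _ T), fst, (dual p T s N h).
split.
- exact: extension_fst.
- exact: (alg_dual p T sS Xh hB Hmn).
- exact: (dual_cauchy IH T sS (fun k => proj1 (NP k)) Xh B0 hB Hmn).
- by apply: (mean_dual sS Xh hB Hmn Xu) => // k; case: (NP k).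
- exact: (mean_sqr_dual sS Xh hB Hmn Xu).
Qed.

End convergence.

(** * Elimination of one sequence by almost optimal approximation *)

Section step.
Context {R : realType} {V : zmodType} (Phi : nat -> {fset V}).
Hypothesis PhiF : folner_avg (R := R) Phi.
Context (G : zmodType) (S : set (V -> G)) (p : V -> G).
Hypothesis IH : @convergent_systems R V Phi ((nat * V -> G)%type : zmodType)
  [set q | (exists2 q0, S q0 & q = lifted q0) \/
           (exists2 q0, S q0 \/ q0 = (fun=> 0) & q = derived p q0)].
Context (X : mean_space R) (T : action G X) (s : seq ((V -> G) * (X -> R))).
Hypothesis sS : forall a, a \in s -> S a.1 /\ alg X a.2.
Context (f : X -> R) (Xf : alg X f).

Let As a : a \in s -> alg X a.2. Proof. by case/sS. Qed.

Let alg_cons (Y : mean_space R) (TY : action G Y) pi g N :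
  extension T TY pi -> alg Y g ->
  alg Y (sysavg TY (Phi N) ((p, g) :: pullback pi s)).
Proof.
move=> ext Yg; apply: alg_sysavg => a; rewrite inE => /orP[/eqP -> //|].
exact: (pullback_alg ext As).
Qed.

Let errors : set R := [set e | exists (Y : mean_space R) (TY : action G Y)
  (pi : Y -> X) (w : Y -> R),
  [/\ extension T TY pi, alg Y w,
      l2_cauchy (fun n => sysavg TY (Phi n) ((p, w) :: pullback pi s)) &
      e = mean Y (fun y => (f (pi y) - w y) ^+ 2)]].

Let errors_ge0 e : errors e -> 0 <= e.
Proof.
move=> [Y [TY [pi [w [[_ piA _] Yw _ ->]]]]].
apply: mean_ge0 => [|y]; last exact: sqr_ge0.
by apply: alg_sqr; apply: algB => //; exact: piA.
Qed.

Let has_inf_errors : has_inf errors.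
Proof.
split; last by exists 0 => e /errors_ge0.
(* The zero function on [X] itself is admissible, since its averages vanish. *)
exists (mean X (fun x => (f x - 0) ^+ 2)); exists X, T, id, (fun=> 0).
split; [exact: extension_id|exact: alg_cst| |by []].
move=> e e0; exists 0%N => n m _ _; rewrite (_ : (fun x => _) = fun=> 0).
  by rewrite mean_cst ltW.
apply/funext => x; rewrite !sysavg_cons.
by under eq_fun do rewrite mul0r; rewrite /avg !big1// !mulr0 subr0 expr0n.
Qed.

Lemma convergent_step : l2_cauchy (fun n => sysavg T (Phi n) ((p, f) :: s)).
Proof.
have [C C0 sC] := sysprod_bounded T As.
(* Two averages of [u] enter with weight 4 and the Cauchy distance for [w] with weight 2:
   [8 * eta + 2 * (e / 4) = e]. *)
move=> e e0; pose eta := e / 16; have eta0 : 0 < eta by rewrite divr_gt0.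
(* [K] bounds the squared norm of the dual function whenever the error of [w] is at most
   [inf errors + 1]; the last 1 makes it positive. It depends neither on the extension nor on [w],
   as [C] survives pullback. *)
pose K := C ^+ 4 * (inf errors + 1) + 1.
have inf0 : 0 <= inf errors.
  by apply: lb_le_inf; [case: has_inf_errors|move=> x /errors_ge0].
have K0 : 0 < K by rewrite ltr_wpDl// mulr_ge0 ?exprn_ge0 ?addr_ge0// ltW.
(* The slack is at most the gain [eta ^+ 2 / K] obtained below, and at most 1 so that [K] is a valid
   bound. *)
have eps0 : 0 < Num.min 1 (eta ^+ 2 / K) by rewrite lt_min ltr01 divr_gt0 ?exprn_gt0.
have [e1 Ee1] := inf_adherent eps0 has_inf_errors.
rewrite -ltrBlDl lt_min => /andP[e1_1 e1_eta].
move: (Ee1) => [Y [TY [pi [w [ext Yw cw e1E]]]]].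
have [_ piA piM] := ext.
pose u y := f (pi y) - w y.
have Yu : alg Y u by apply: algB => //; exact: piA.
have [small|nsmall] := pselect (exists k, forall n, (k <= n)%N ->
    mean Y (fun y => sysavg TY (Phi n) ((p, u) :: pullback pi s) y ^+ 2) <= eta).
  have [k kP] := small; have e40 : 0 < e / 4 by rewrite divr_gt0.
  have [N0 N0P] := cw _ e40.
  exists (maxn k N0) => n m; rewrite !geq_max => /andP[kn Nn] /andP[km Nm].
  have XA n0 : alg X (sysavg T (Phi n0) ((p, f) :: s)).
    by apply: alg_sysavg => a; rewrite inE => /orP[/eqP -> //|/As].
  have decomp n0 y : sysavg T (Phi n0) ((p, f) :: s) (pi y) =
      sysavg TY (Phi n0) ((p, u) :: pullback pi s) y +
      sysavg TY (Phi n0) ((p, w) :: pullback pi s) y.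
    rewrite !sysavg_cons -avgD; apply: eq_avg => v.
    rewrite (sysprod_pullback _ _ _ ext) -mulrDl; congr (_ * _).
    by case: ext => piT _ _; rewrite -piT /u subrK.
  rewrite -(piM (fun x => _)); last exact/alg_sqr/algB.
  under eq_fun do rewrite !decomp.
  have YU n0 := alg_cons n0 ext Yu; have YW n0 := alg_cons n0 ext Yw.
  have := N0P n m Nn Nm; have := kP n kn; have := kP m km.
  set a := sysavg TY (Phi n) ((p, u) :: _); set b := sysavg TY (Phi m) ((p, u) :: _).
  set c := sysavg TY (Phi n) ((p, w) :: _); set d := sysavg TY (Phi m) ((p, w) :: _).
  have Ya2 : alg Y (fun y => a y ^+ 2) by exact/alg_sqr/YU.
  have Yb2 : alg Y (fun y => b y ^+ 2) by exact/alg_sqr/YU.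
  have Ycd : alg Y (fun y => (c y - d y) ^+ 2) by apply/alg_sqr/algB; exact: YW.
  move=> bs as_ cds.
  apply: (@le_trans _ _ (mean Y (fun y => 4 * a y ^+ 2 + 4 * b y ^+ 2 +
      2 * (c y - d y) ^+ 2))).
    apply: ler_mean => [||y].
    - by apply/alg_sqr/algB; apply: algD; (exact: YU || exact: YW).
    - by apply: algD; [apply: algD; exact: algZ|exact: algZ].
    - have := sqr_ge0 (a y + b y); have := sqr_ge0 (a y - b y - (c y - d y)).
      by nra.
  rewrite meanD ?meanD ?meanZ//; try (exact: algZ); last first.
    by apply: algD; exact: algZ.
  by move: bs as_ cds; rewrite /eta; lra.
exfalso.
have bad k : exists2 n, (k <= n)%N &
    eta <= mean Y (fun y => sysavg TY (Phi n) ((p, u) :: pullback pi s) y ^+ 2).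
  apply: contrapT => nex; apply: nsmall; exists k => n kn.
  by rewrite leNgt; apply/negP => /ltW lt; apply: nex; exists n.
have sS' a : a \in pullback pi s -> S a.1 /\ alg Y a.2.
  by move=> /mapP[b /sS[Sb Xb] ->]; split => //; exact: piA.
have sC' v y : `|sysprod TY (pullback pi s) v y| <= C.
  by rewrite (sysprod_pullback _ _ _ ext).
have [Z [TZ [rho [g [ext' Zg cg corr norm]]]]] :=
  exists_dual PhiF IH sS' Yu sC' bad.
have [_ rhoA rhoM] := ext'.
(* Replacing [w] by [w + t * g] changes the error by at most [- 2 * t * eta + t ^+ 2 * K], which is
   minimal for this [t], with value [- eta ^+ 2 / K]. *)
pose t := eta / K.
have : errors (mean Z (fun z => (f (pi (rho z)) - (w (rho z) + t * g z)) ^+ 2)).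
  exists Z, TZ, (pi \o rho), (fun z => w (rho z) + t * g z).
  split => //; first exact: extension_comp ext ext'.
    by apply: algD; [exact: rhoA|exact: algZ].
  have algZ_cons g' n : alg Z g' ->
      alg Z (sysavg TZ (Phi n) ((p, g') :: pullback rho (pullback pi s))).
    move=> Zg'; apply: alg_sysavg => a; rewrite inE => /orP[/eqP -> //|].
    exact: (pullback_alg ext' (pullback_alg ext As)).
  rewrite (_ : (fun n => _) = (fun n z =>
      sysavg TY (Phi n) ((p, w) :: pullback pi s) (rho z) +
      t * sysavg TZ (Phi n) ((p, g) :: pullback rho (pullback pi s)) z)).
    apply: l2_cauchyD => [n|n||]; [exact/rhoA/alg_cons|exact/algZ/algZ_cons| |].
    - exact: (l2_cauchy_pullback ext' (fun n => alg_cons n ext Yw) cw).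
    - by apply: l2_cauchyM => // [|n]; [exact: alg_cst|exact: algZ_cons].
  apply/funext => n; apply/funext => z.
  rewrite pullback_comp.
  by rewrite sysavg_consD sysavg_consZ -(sysavg_pullback _ _ _ ext').
move=> /(ge_inf has_inf_errors.2); rewrite leNgt => /negP; apply.
rewrite (_ : (fun z => _) = (fun z => u (rho z) ^+ 2 - 2 * t * (u (rho z) * g z) +
   t ^+ 2 * g z ^+ 2)); last by apply/funext => z; rewrite /u; ring.
have Zu : alg Z (fun z => u (rho z)) by exact: rhoA.
have Zu2 : alg Z (fun z => u (rho z) ^+ 2) by exact: alg_sqr.
have Zug : alg Z (fun z => u (rho z) * g z) by exact: algM.
have Zg2 : alg Z (fun z => g z ^+ 2) by exact: alg_sqr.
rewrite meanD ?meanB ?meanZ//; try (exact: algZ); last first.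
  by apply: algB => //; exact: algZ.
rewrite (rhoM _ (alg_sqr Yu)) -e1E.
have tK : t * K = eta by rewrite divfK// gt_eqF.
have t0 : 0 < t by rewrite divr_gt0.
have e1t : e1 < inf errors + t * eta.
  by move: e1_eta; rewrite ltrBlDl /t expr2 mulrAC.
move: norm; rewrite -e1E => norm.
have : mean Z (fun z => g z ^+ 2) <= K.
  apply: (le_trans norm); rewrite /K -[leLHS]addr0; apply: lerD => //.
  by rewrite ler_wpM2l ?exprn_ge0 ?ltW// -ltrBlDl.
move: corr tK e1t t0; set c := mean Z _; set d := mean Z _ => corr tK e1t t0 dK.
have : t ^+ 2 * d <= t * eta.
  by rewrite expr2 -mulrA (ler_pM2l t0) -tK (ler_pM2l t0).
have : t * eta <= t * c by rewrite (ler_pM2l t0).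
by move: e1t; nra.
Qed.

End step.

(** * Polynomial sequences and their degrees *)

Section polynomial_sequences.
Context {V G : zmodType}.
Implicit Types q r c : V -> G.

(* For integer-valued [q] on a lattice: [q] is a polynomial of degree less than
   [n]. *)
Fixpoint polyseq_lt (n : nat) q : Prop :=
  if n is n'.+1 then forall m, polyseq_lt n' (fun u => q (u + m) - q u)
  else forall u, q u = 0.

Lemma polyseq_lt0 n : polyseq_lt n (fun=> 0).
Proof.
by elim: n => //= n IH m; under eq_fun do rewrite subr0.
Qed.

Lemma polyseq_ltD n q r : polyseq_lt n q -> polyseq_lt n r ->
  polyseq_lt n (fun u => q u + r u).
Proof.
elim: n q r => [|n IH] q r /= qn rn; first by move=> u; rewrite qn rn addr0.
move=> m; under eq_fun do rewrite opprD addrACA.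
exact: IH.
Qed.

Lemma polyseq_ltN n q : polyseq_lt n q -> polyseq_lt n (fun u => - q u).
Proof.
elim: n q => [|n IH] q /= qn; first by move=> u; rewrite qn oppr0.
by move=> m; under eq_fun do rewrite -opprD; exact: IH.
Qed.

Lemma polyseq_ltS n q : polyseq_lt n q -> polyseq_lt n.+1 q.
Proof.
elim: n q => [|n IH] q qn m /=; first by move=> u; rewrite !qn subr0.
exact: (IH _ (qn m)).
Qed.

Lemma polyseq_lt_leq n k q : (n <= k)%N -> polyseq_lt n q -> polyseq_lt k q.
Proof.
move=> /subnKC <-; elim: (k - n)%N => [|j IH] qn; first by rewrite addn0.
by rewrite addnS; exact/polyseq_ltS/IH.
Qed.

Lemma polyseq_lt1 q u v : polyseq_lt 1 q -> q u = q v.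
Proof.
by move=> q1; have := q1 (u - v) v; rewrite [v + _]addrC subrK => /subr0_eq.
Qed.

(** For each [n] this is an equivalence relation, coarser as [n] grows: an ultrametric closeness,
    with [n] as the distance. *)
Definition polynear n q r := polyseq_lt n (fun u => q u - r u).

Lemma polynear_refl n q : polynear n q q.
Proof. by rewrite /polynear; under eq_fun do rewrite subrr; exact: polyseq_lt0. Qed.

Lemma polynear_sym n q r : polynear n q r -> polynear n r q.
Proof. by move=> /polyseq_ltN; rewrite /polynear; under eq_fun do rewrite opprB. Qed.

Lemma polynear_trans n q r c : polynear n q r -> polynear n r c -> polynear n q c.
Proof.
move=> qr rc; rewrite /polynear.
rewrite (_ : (fun u => _) = (fun u => (q u - r u) + (r u - c u))).
  exact: polyseq_ltD.
by apply/funext => u; rewrite addrA subrK.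
Qed.

Lemma polynear_leq n k q r : (n <= k)%N -> polynear n q r -> polynear k q r.
Proof. exact: polyseq_lt_leq. Qed.

Lemma polynear0 n q : polynear n q (fun=> 0) = polyseq_lt n q.
Proof. by rewrite /polynear; under eq_fun do rewrite subr0. Qed.

End polynomial_sequences.

(** Differences are computed coordinatewise, so a common degree bound turns a family indexed by [I]
    into one polynomial sequence. *)
Lemma polyseq_lt_fct {V G : zmodType} {I : Type} n (Q : V -> (I -> G)) :
  (forall i, polyseq_lt n (Q^~ i)) ->
  polyseq_lt n (Q : V -> ((I -> G)%type : zmodType)).
Proof.
elim: n Q => [|n IH] Q QP /= m; first by apply/funext => i; exact: QP.
by apply: IH => i; exact: QP.
Qed.

Section lifting.
Context {V G : zmodType}.
Implicit Types p q r c : V -> G.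

Lemma polynear_lifted n q r : polynear n q r ->
  polynear n (lifted q : V -> ((nat * V -> G)%type : zmodType)) (lifted r).
Proof. by move=> qr; apply: polyseq_lt_fct. Qed.

(** The sequence [derived p q] minus [lifted c] is [q - c] plus a difference of [q - p], and taking
    a difference lowers the degree by one. *)
Lemma polynear_derived n p q c : polynear n q c -> polynear n.+1 q p ->
  polynear n (derived p q : V -> ((nat * V -> G)%type : zmodType)) (lifted c).
Proof.
move=> qc qp; apply: polyseq_lt_fct => i.
rewrite (_ : (fun u => _) = (fun u => (q u - c u) +
    ((q (u + i.2) - p (u + i.2)) - (q u - p u)))).
  by apply: polyseq_ltD => //; exact: qp.
apply/funext => u; rewrite opprB [RHS]addrC -[RHS]addrA.
rewrite [p u - q u + _]addrA subrK addrA -[q _ - _ + _]addrA [- _ + p u]addrC.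
by [].
Qed.

End lifting.

(** * Induction on systems of polynomial sequences *)

(** The order is lexicographic in the values at [1, ..., D], the largest index being the most
    significant; the value at 0 is free. Induction on [D] contains a strong induction on the value
    at the top index. *)
Lemma lex_ind (D : nat) (P : (nat -> nat) -> Prop) :
  (forall g, (forall f, (exists i, [/\ (0 < i <= D)%N, (f i < g i)%N &
                           forall j, (i < j)%N -> f j = g j]) -> P f) -> P g) ->
  forall g, P g.
Proof.
elim: D P => [|D IH] P step; first by move=> g; apply: step => f [[|i] [//]].
suff claim n : forall g, g D.+1 = n -> P g by move=> g; exact: (claim (g D.+1)).
elim/ltn_ind: n => n IHn g gn.
apply: (IH (fun f => f D.+1 = n -> P f) _ g gn) => {g gn} g IHg gn.
apply: step => f [i [/andP[i0 iD] fg fgj]].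
move: iD; rewrite leq_eqVlt ltnS => /orP[/eqP iD|iD].
  by apply: (IHn (f D.+1)) => //; rewrite -gn -iD.
by apply: IHg; [exists i; rewrite i0 iD|rewrite fgj ?ltnS].
Qed.

Section pet.
Context {R : realType} {V : zmodType} (Phi : nat -> {fset V}).
Hypothesis PhiF : folner_avg (R := R) Phi.

Local Notation convergent := (@convergent_systems R V Phi).

Lemma convergent_sub (G : zmodType) (S S' : set (V -> G)) :
  (forall q, S q -> S' q) -> convergent S' -> convergent S.
Proof. by move=> SS' cS' X T s sS; apply: cS' => a /sS[/SS']. Qed.

(* [cs i] lists the centres of the balls of level [i], which have radius [i]
   and whose centres are at distance [i + 1] from a common reference point. *)
Definition covered (G : zmodType) D (cs : nat -> seq (V -> G)) (q : V -> G) :=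
  polyseq_lt D q \/
  exists i c, [/\ (0 < i <= D)%N, c \in cs i & polynear i q c].

(** A sequence at distance 1 from [p] differs from it by a constant, so its function, moved by that
    constant, can be absorbed into [f]. *)
Lemma merge_near (G : zmodType) (X : mean_space R) (T : action G X) p f
    (s1 s2 : seq ((V -> G) * (X -> R))) F x :
  (forall a, a \in s1 -> polynear 1 a.1 p) ->
  sysavg T F ((p, f) :: s1 ++ s2) x =
  sysavg T F ((p, fun x => f x *
    sysprod T [seq (fun _ : V => a.1 0 - p 0, a.2) | a <- s1] 0 x) :: s2) x.
Proof.
move=> s1p; apply: eq_avg => u; rewrite /sysprod !big_cons big_cat /= mulrA.
congr (_ * _ * _); rewrite big_map big_seq [RHS]big_seq.
apply: eq_bigr => a /s1p ap /=; rewrite -actD.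
by rewrite (polyseq_lt1 0 u ap) subrK.
Qed.

Lemma convergent_const (G : zmodType) : convergent [set q : V -> G | polyseq_lt 1 q].
Proof.
move=> X T s sP e e0; exists 0%N => n m _ _.
rewrite (_ : (fun x => _) = fun=> 0) ?mean_cst ?ltW//.
apply/funext => x; rewrite (_ : sysavg T (Phi n) s x = sysavg T (Phi m) s x).
  by rewrite subrr expr0n.
have PE k : sysavg T (Phi k) s x = sysprod T s 0 x.
  rewrite -[RHS](avg_cst _ (PhiF.1 k)); apply: eq_avg => u.
  rewrite /sysprod big_seq [RHS]big_seq.
  by apply: eq_bigr => a /sP[/= a1 _]; rewrite (polyseq_lt1 u 0 a1).
by rewrite !PE.
Qed.

(** Induction on the numbers of balls, larger radii being more significant. Let [i] be the lowest
    occupied positive level and [c] a centre there. If no sequence of the system is near [c], this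
    ball is dropped. Otherwise one near [c] is eliminated by [convergent_step]: it becomes the
    reference point, the ball of [c] disappears, and new balls arise at level [i - 1] only. Without
    balls all degrees are lower, and [IH] applies. *)
Lemma convergent_covered D :
  (forall G : zmodType, convergent [set q : V -> G | polyseq_lt D.+1 q]) ->
  forall (v : nat -> nat) (G : zmodType) (p : V -> G) (cs : nat -> seq (V -> G)),
    polyseq_lt D.+2 p ->
    (forall i c, c \in cs i -> polynear i.+1 c p) ->
    (forall i, size (cs i) = v i) ->
  convergent [set q | covered D.+1 cs q].
Proof.
move=> IH; apply: (@lex_ind D.+1) => v IHv G p cs pD csp csv.
have [[i0 i0P]|none] := pselect (exists i, (0 < i <= D.+1)%N && (0 < size (cs i))%N);
    last first.
  apply: convergent_sub (IH G) => q [//|[i [c [iD ci _]]]].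
  by exfalso; apply: none; exists i; rewrite iD; case: (cs i) ci.
case: (@ex_minnP (fun i => (0 < i <= D.+1)%N && (0 < size (cs i))%N)).
  by exists i0.
move=> {i0 i0P} i /andP[iD] + imin.
case csi : (cs i) => [//|c rest] _ X T s sP.
have [i_gt0 i_le] := andP iD.
have cp : polynear i.+1 c p by apply: csp; rewrite csi mem_head.
have [[a0 a0s a0c]|far] :=
  pselect (exists2 a, a \in s & polynear i a.1 c); last first.
  pose cs' j := if j == i then rest else cs j.
  apply: (IHv (fun j => size (cs' j)) _ G p cs' pD) => //.
  - exists i; split => //; first by rewrite /cs' eqxx -csv csi.
    by move=> j ij; rewrite /cs' gtn_eqF// csv.
  - move=> j d; rewrite /cs'; case: eqP => [-> dr|_]; last exact: csp.
    by apply: csp; rewrite csi in_cons dr orbT.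
  - move=> a As; have [aP Xa] := sP a As; split => //.
    case: aP => [|[j [d [jD dj ad]]]]; first by left.
    right; exists j, d; split => //; rewrite /cs'; case: eqP => // ji.
    move: dj; rewrite ji csi in_cons => /orP[/eqP dc|//].
    by exfalso; apply: far; exists a => //; rewrite -dc -ji.
pose p' := a0.1.
have p'p : polynear i.+1 p' p by apply: polynear_trans cp; exact: polynear_leq a0c.
have p'D : polyseq_lt D.+2 p'.
  rewrite -polynear0; apply: (polynear_trans (r := p)); last by rewrite polynear0.
  exact: polynear_leq p'p.
pose isnear (a : (V -> G) * (X -> R)) := `[< polynear 1 a.1 p' >].
pose s1 := [seq a <- rem a0 s | isnear a].
pose s2 := [seq a <- rem a0 s | ~~ isnear a].
have s2P a : a \in s2 -> [/\ ~ polynear 1 a.1 p', covered D.+1 cs a.1 & alg X a.2].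
  rewrite mem_filter => /andP[/asboolPn na /mem_rem as_].
  by have [] := sP a as_.
have ss12 : perm_eq s (a0 :: s1 ++ s2).
  by rewrite (perm_trans (perm_to_rem a0s))// perm_cons perm_sym perm_filterC.
have s1P a : a \in s1 -> polynear 1 a.1 p' /\ alg X a.2.
  rewrite mem_filter => /andP[/asboolP na /mem_rem as_].
  by have [] := sP a as_.
pose f' x := a0.2 x * sysprod T [seq (fun _ : V => a.1 0 - p' 0, a.2) | a <- s1] 0 x.
rewrite (_ : (fun n => _) = (fun n => sysavg T (Phi n) ((p', f') :: s2))); last first.
  apply/funext => n; apply/funext => x; rewrite (perm_sysavg T _ ss12).
  rewrite {1}[a0]surjective_pairing; apply: merge_near => a /s1P[].
  by [].
have Xf' : alg X f'.
  apply: algM; first by have [] := sP a0 a0s.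
  by apply: alg_sysprod => a /mapP[b /s1P[_ Xb] ->].
(* The remaining sequences in the ball of [c] are at distance [i] from [p'], so they may serve as
   their own centres at level [i - 1]. *)
pose cs' j := if (i < j)%N then cs j else if j == i then rest else
  if j.+1 == i then [seq a.1 | a <- s2 & `[< polynear i a.1 c >]] else [::].
have cs'p j d : d \in cs' j -> polynear j.+1 d p'.
  rewrite /cs'; case: ltnP => [ij /csp dp|ji].
    by apply: polynear_trans dp _; apply/polynear_sym/(polynear_leq _ p'p)/leqW.
  case: eqP => [-> dr|_].
    apply: (polynear_trans (r := p)); last exact: polynear_sym.
    by apply: csp; rewrite csi in_cons dr orbT.
  case: eqP => // -> /mapP[a]; rewrite mem_filter => /andP[/asboolP ac _] ->.
  exact: polynear_trans ac (polynear_sym a0c).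
(* The pair of [D.+1] and the zero sequence stands for the sequences of degree at most [D], which
   [covered] treats apart from the balls. *)
pose target n d :=
  (n = D.+1 /\ d = (fun=> 0)) \/ ((0 < n <= D.+1)%N /\ d \in cs' n).
(* Distance [n] to the target and [n.+1] to [p'] are the two inputs of [polynear_derived]. *)
have s2_target a : a \in s2 ->
    exists n d, [/\ target n d, polynear n a.1 d & polynear n.+1 a.1 p'].
  move=> as2; have [na aP _] := s2P a as2; case: aP => [aD|[j [d [jD dj ad]]]].
    exists D.+1, (fun=> 0); split; [by left|by rewrite polynear0|].
    apply: polynear_trans (polynear_leq (leqnSn _) (_ : polynear D.+1 _ (fun=> 0))) _.
      by rewrite polynear0.
    by apply: polynear_sym; rewrite polynear0.
  have cs'_near : d \in cs' j ->
      exists n d, [/\ target n d, polynear n a.1 d & polynear n.+1 a.1 p'].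
    move=> dj'; exists j, d; split => //; first by right.
    exact: polynear_trans (polynear_leq (leqnSn _) ad) (cs'p _ _ dj').
  have ij : (i <= j)%N by apply: imin; rewrite jD; case: (cs j) dj.
  move: ij; rewrite leq_eqVlt => /orP[/eqP ij|ij]; last first.
    by apply: cs'_near; rewrite /cs' ij.
  move: dj; rewrite -ij csi in_cons => /orP[/eqP dc|dr]; last first.
    by apply: cs'_near; rewrite /cs' -ij ltnn eqxx.
  rewrite -ij dc in ad.
  have ap' : polynear i a.1 p' := polynear_trans ad (polynear_sym a0c).
  (* For [i = 1] the sequence would differ from [p'] by a constant, but those have been merged;
     hence the level [i - 1] is positive. *)
  case: i i_gt0 ap' ad @cs' @target cs'p cs'_near i_le
    {iD imin csi cp a0c p'p ij} => //.
  move=> [|i] _ ap' ad cs' target cs'p _ i_le; first by case: na.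
  exists i.+1, a.1; split => //; last exact: polynear_refl.
  right; split; first exact: ltnW i_le.
  rewrite /cs' ltnNge leqnSn /= eqn_leq ltnn andbF eqxx.
  by apply/mapP; exists a => //; rewrite mem_filter as2 andbT; exact/asboolP.
have lifted_ok : convergent [set q | covered D.+1 (fun j =>
    [seq lifted d : V -> ((nat * V -> G)%type : zmodType) | d <- cs' j]) q].
  apply: (IHv (fun j => size (cs' j)) _ _ (lifted p')).
  - exists i; split => //; first by rewrite /cs' ltnn eqxx -csv csi.
    by move=> j ij; rewrite /cs' ij csv.
  - rewrite -polynear0; apply: (polynear_lifted (r := fun=> 0)); rewrite polynear0//.
  - by move=> j d /mapP[d' /cs'p dp ->]; exact: polynear_lifted.
  - by move=> j; rewrite size_map.
have target_covered n d (q : V -> ((nat * V -> G)%type : zmodType)) :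
    target n d -> polynear n q (lifted d) ->
    covered D.+1 (fun j =>
      [seq lifted d : V -> ((nat * V -> G)%type : zmodType) | d <- cs' j]) q.
  case=> [[-> ->]|[nD dn] qd]; first by left; rewrite -polynear0.
  by right; exists n, (lifted d); split => //; apply/mapP; exists d.
apply: (convergent_step PhiF (S := fun q => exists2 a, a \in s2 & q = a.1)) => //;
    last first.
  by move=> a as2; split; [exists a|case: (s2P a as2)].
apply: convergent_sub lifted_ok => q [[_ [a as2 ->] ->]|[q0 q0P ->]].
  have [n [d [nd ad _]]] := s2_target a as2.
  by apply: target_covered nd _; exact: polynear_lifted.
case: q0P => [[a as2 ->]|->].
  have [n [d [nd ad ap]]] := s2_target a as2.
  by apply: target_covered nd _; exact: polynear_derived.
(* The zero sequence, which carries [h] in [sysY], becomes the opposite of a difference of [p'], of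
   degree at most [D]. *)
apply: (target_covered D.+1 (fun=> 0)); first by left.
apply: polynear_derived; first exact: polynear_refl.
by apply: polynear_sym; rewrite polynear0.
Qed.

Theorem convergent_polyseq D (G : zmodType) :
  convergent [set q : V -> G | polyseq_lt D q].
Proof.
case: D => [|D].
  by apply: convergent_sub (@convergent_const G) => q; exact: polyseq_ltS.
elim: D G => [|D IH] G; first exact: convergent_const.
move=> X T s sP.
(* Initially each sequence is its own centre at the top level, and the reference point is 0. *)
pose cs j : seq (V -> G) := if j == D.+1 then [seq a.1 | a <- s] else [::].
apply: (@convergent_covered D IH (fun j => size (cs j)) G (fun=> 0) cs).
- exact: polyseq_lt0.
- move=> j c; rewrite /cs; case: eqP => // -> /mapP[a /sP[aD _] ->].
  by rewrite polynear0.
- by [].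
- move=> a As; split; last by case: (sP a As).
  right; exists D.+1, a.1; split => //; last exact: polynear_refl.
    by rewrite leqnn.
  by rewrite /cs eqxx; apply/mapP; exists a.
Qed.

End pet.

(** * Integer polynomials and Følner sequences in lattices *)

Section polynomials.
Context {V : zmodType}.

Lemma polyseq_lt_shift (G : zmodType) n (q : V -> G) v :
  polyseq_lt n q -> polyseq_lt n (fun u => q (u + v)).
Proof.
elim: n q => [|n IH] q qn /=; first by move=> u; exact: qn.
by move=> m; under eq_fun do rewrite addrAC; exact: (IH _ (qn m)).
Qed.

(** By the discrete Leibniz rule, each of the two terms in the difference of a product lowers one of
    the degrees, whence the induction on [a + b]. *)
Lemma polyseq_ltM (K : comRingType) a b (f g : V -> K) :
  polyseq_lt a f -> polyseq_lt b g -> polyseq_lt (a + b) (fun u => f u * g u).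
Proof.
have [n] := ubnP (a + b); elim: n => // n IH in a b f g *.
case: a => [_ fa _|a].
  rewrite (_ : (fun u => _) = fun=> 0); first exact: polyseq_lt0.
  by apply/funext => u; rewrite fa mul0r.
case: b => [_ _ gb|b].
  rewrite (_ : (fun u => _) = fun=> 0); first exact: polyseq_lt0.
  by apply/funext => u; rewrite gb mulr0.
rewrite ltnS addSn => abn fa gb m.
rewrite -/(polyseq_lt _ _) (_ : (fun u => _) = (fun u =>
  (f (u + m) - f u) * g (u + m) + f u * (g (u + m) - g u))); last first.
  by apply/funext => u; ring.
apply: polyseq_ltD; first by apply: (IH a b.+1) => //; exact: polyseq_lt_shift.
by rewrite -addSnnS; apply: (IH a.+1 b) => //; rewrite addSnnS.
Qed.

Definition polyseq (G : zmodType) (q : V -> G) := exists n, polyseq_lt n q.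

Lemma polyseqD (G : zmodType) (q r : V -> G) :
  polyseq q -> polyseq r -> polyseq (fun u => q u + r u).
Proof.
move=> [a qa] [b rb]; exists (maxn a b).
by apply: polyseq_ltD; [apply: polyseq_lt_leq qa|apply: polyseq_lt_leq rb];
   rewrite leq_max leqnn ?orbT.
Qed.

Lemma polyseqM (K : comRingType) (q r : V -> K) :
  polyseq q -> polyseq r -> polyseq (fun u => q u * r u).
Proof. by move=> [a qa] [b rb]; exists (a + b)%N; exact: polyseq_ltM. Qed.

Lemma polyseq_cst (G : zmodType) (c : G) : polyseq (fun _ : V => c).
Proof. by exists 1%N => m u; rewrite subrr. Qed.

Lemma polyseq_sum (G : zmodType) (I : Type) (s : seq I) (F : I -> V -> G) :
  (forall i, polyseq (F i)) -> polyseq (fun u => \sum_(i <- s) F i u).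
Proof.
move=> FP; elim: s => [|i s IH].
  by under eq_fun do rewrite big_nil; exact: polyseq_cst.
by under eq_fun do rewrite big_cons; exact: polyseqD.
Qed.

Lemma polyseq_prod (K : comRingType) (I : Type) (s : seq I) (F : I -> V -> K) :
  (forall i, polyseq (F i)) -> polyseq (fun u => \prod_(i <- s) F i u).
Proof.
move=> FP; elim: s => [|i s IH].
  by under eq_fun do rewrite big_nil; exact: polyseq_cst.
by under eq_fun do rewrite big_cons; exact: polyseqM.
Qed.

Lemma polyseqX (K : comRingType) (q : V -> K) k :
  polyseq q -> polyseq (fun u => q u ^+ k).
Proof.
move=> qP; elim: k => [|k IH]; first exact: polyseq_cst.
by under eq_fun do rewrite exprS; exact: polyseqM.
Qed.

Lemma polyseq_row (l : nat) (q : 'I_l -> V -> int) : (forall j, polyseq (q j)) ->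
  polyseq (fun u => \row_j q j u).
Proof.
(* The row is split into rows with one nonzero entry, so that [polyseq_sum] reconciles the different
   degrees. *)
move=> qP; rewrite (_ : (fun u => _) =
    (fun u => \sum_(j <- index_enum 'I_l) \row_i (q j u *+ (i == j)))); last first.
  apply/funext => u; apply/rowP => i; rewrite summxE (bigD1 i)//= !mxE eqxx.
  rewrite big1 ?addr0// => j ji; rewrite mxE eq_sym (negbTE ji).
  by [].
apply: polyseq_sum => j; have [n jn] := qP j; exists n.
elim: n (q j) jn => [|n IH] r rn /=.
  by move=> u; apply/rowP => i; rewrite !mxE rn mul0rn.
move=> m; rewrite (_ : (fun u => _) =
  (fun u => \row_i ((r (u + m) - r u) *+ (i == j)))); first exact: IH.
by apply/funext => u; apply/rowP => i; rewrite !mxE mulrnBl.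
Qed.

End polynomials.

(** Monomials are handled over [rat], where the coefficients live. The embedding of [int] is
    injective and commutes with differences, so the degree bound returns to [p]. *)
Lemma integer_polynomial_polyseq (m : nat) (p : 'rV[int]_m -> int) :
  integer_polynomial p -> polyseq p.
Proof.
move=> [q pq].
have [n pn] : polyseq (fun u => (p u)%:~R : rat).
  under eq_fun do rewrite pq mpoly.mevalE.
  apply: polyseq_sum => k; apply: polyseqM; first exact: polyseq_cst.
  (* Coordinates are additive, hence of degree less than 2. *)
  apply: polyseq_prod => i; apply: polyseqX; exists 2%N => v w u.
  by rewrite !mxE !intrD; ring.
exists n; elim: n p {pq} pn => [|n IH] p /= pn.
  by move=> u; apply/eqP; rewrite -(intr_eq0 rat) pn.
by move=> v; apply: IH; under eq_fun do rewrite intrB; exact: pn.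
Qed.

(** The sums over [g + Phi N] and [Phi N] cancel on the intersection; what is left is at most [B]
    times the size of the symmetric difference. *)
Lemma folner_folner_avg (R : realType) (m : nat) (Phi : nat -> {fset 'rV[int]_m}) :
  folner R Phi -> folner_avg (R := R) Phi.
Proof.
move=> [Phi0 PhiF]; split => // g e e0.
have /cvgrPdist_lt /(_ e e0) [N0 _ N0P] := PhiF g.
exists N0 => N /N0P /= Ne h B hB.
set gP := [fset (g + u)%R | u in Phi N]%fset.
have B0 : 0 <= B by exact: le_trans (normr_ge0 _) (hB 0).
have -> : avg (Phi N) (fun u => h (g + u)) =
    (#|` Phi N|%:R)^-1 * \sum_(u <- gP) h u.
  by rewrite /avg big_imfset//= => x y _ _; exact: addrI.
rewrite -mulrBr normrM.
have split_sum (A C : {fset 'rV[int]_m}) : \sum_(u <- A) h u =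
    \sum_(u <- (A `&` C)%fset) h u + \sum_(u <- (A `\` C)%fset) h u.
  rewrite (_ : (A `&` C)%fset = [fset x in A | x \in C]%fset); last first.
    by apply/fsetP => u; rewrite !inE.
  rewrite (_ : (A `\` C)%fset = [fset x in A | x \notin C]%fset).
    exact: (big_fsetID _ (mem C)).
  by apply/fsetP => u; rewrite !inE andbC.
rewrite (split_sum gP (Phi N)) (split_sum (Phi N) gP) fsetIC.
rewrite opprD addrACA subrr add0r.
have sum_le (A : {fset 'rV[int]_m}) : `|\sum_(u <- A) h u| <= #|` A|%:R * B.
  rewrite (le_trans (ler_norm_sum _ _ _))//.
  rewrite (le_trans (ler_sum _ (fun u _ => hB u)))//.
  by rewrite big_const_seq count_predT iter_addr_0 mulr_natl.
rewrite ger0_norm ?invr_ge0//.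
apply: (@le_trans _ _ (#|` (gP `\` Phi N) `|` (Phi N `\` gP)|%fset%:R /
    #|` Phi N|%fset%:R * B)).
  rewrite mulrAC mulrC ler_wpM2r ?invr_ge0//.
  rewrite (le_trans (ler_normB _ _))// (le_trans (lerD (sum_le _) (sum_le _)))//.
  rewrite -mulrDl -natrD ler_wpM2r// ler_nat -cardfsUI.
  by rewrite [X in (_ + #|` X|)%N](_ : _ = fset0) ?cardfs0 ?addn0//;
     apply/fsetP => u; rewrite !inE; case: (u \in Phi N); case: (u \in gP).
rewrite ler_wpM2r//; move: Ne; rewrite sub0r normrN => /ltW; apply: le_trans.
exact: ler_norm.
Qed.

(** * A probability space as a mean space *)

Section bounded_measurable_functions.
Context {d : measure_display} {X : measurableType d} {R : realType}.
Context (mu : probability X R).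

Definition bounded_measurable : set (X -> R) := fun f =>
  measurable_fun [set: X] f /\ bounded_family f.

Lemma bounded_measurable_integrable f : bounded_measurable f ->
  mu.-integrable [set: X] (EFin \o f).
Proof.
move=> [mf [B fB]]; apply: measurable_bounded_integrable => //.
  by rewrite -ge0_fin_numE ?fin_num_measure.
exists B; split; first exact: num_real.
by move=> M BM x _; apply: le_trans (fB x) (ltW BM).
Qed.

(** Functions are bounded everywhere, as [alg_bounded] demands; essentially bounded ones enter
    through [Lfun_infty_bounded]. *)
Definition probability_mean_space : mean_space R.
Proof.
refine (@MeanSpace R X bounded_measurable (fun f => \int[mu]_x f x)
  _ _ _ _ _ _ _ _).
- by move=> c; split; [exact: measurable_cst|exists `|c|].
- move=> f g [mf bf] [mg bg]; split; first exact: measurable_funD.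
  exact: bounded_familyD.
- move=> f g [mf bf] [mg bg]; split; first exact: measurable_funM.
  exact: bounded_familyM.
- by move=> f [].
- by move=> f g /bounded_measurable_integrable mf /bounded_measurable_integrable mg;
     rewrite RintegralD.
- by move=> c f /bounded_measurable_integrable mf; rewrite RintegralZl.
- by move=> f _ f0; apply: Rintegral_ge0.
- by rewrite Rintegral_cst//= probability_setT mul1r.
Defined.

Definition measure_preserving (S : X -> X) := measurable_fun [set: X] S /\
  forall A, measurable A -> mu (S @^-1` A) = mu A.

Lemma measure_preserving_id : measure_preserving id.
Proof. by split => //; exact: measurable_id. Qed.

Lemma measure_preserving_comp S S' : measure_preserving S ->
  measure_preserving S' -> measure_preserving (S \o S').
Proof.
move=> [mS muS] [mS' muS']; split=> [|A mA]; first exact: measurableT_comp.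
by rewrite comp_preimage muS' ?muS// -[X in measurable X]setTI; exact: mS.
Qed.

Lemma measure_preserving_iter S n :
  measure_preserving S -> measure_preserving (iter n S).
Proof.
move=> mpS; elim: n => [|n IH]; first exact: measure_preserving_id.
exact: (measure_preserving_comp mpS IH).
Qed.

Lemma bounded_measurable_comp S f : measure_preserving S ->
  bounded_measurable f -> bounded_measurable (fun x => f (S x)).
Proof.
move=> [mS _] [mf [B fB]]; split; first exact: measurableT_comp mf mS.
by exists B => x; exact: fB.
Qed.

Lemma Rintegral_measure_preserving S f : measure_preserving S ->
  bounded_measurable f -> \int[mu]_x f (S x) = \int[mu]_x f x.
Proof.
move=> mpS bf; have [mS muS] := mpS; have [mf _] := bf.
rewrite /Rintegral; congr fine.
have := @integral_pushforward _ _ _ _ R S mS mu [set: X] (EFin \o f).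
rewrite preimage_setT => <- //; last 2 first.
- exact/measurable_EFinP.
- exact/bounded_measurable_integrable/bounded_measurable_comp.
by apply: eq_measure_integral => A mA _; exact: muS.
Qed.

Lemma measure_preserving_ae S (P : X -> Prop) : measure_preserving S ->
  {ae mu, forall x, P x} -> {ae mu, forall x, P (S x)}.
Proof.
move=> [mS muS] [N [mN N0 PN]]; exists (S @^-1` N); split.
- by rewrite -[X in measurable X]setTI; exact: mS.
- by rewrite muS.
- by move=> x nP; exact: PN.
Qed.

End bounded_measurable_functions.

(** * The lattice action generated by commuting transformations *)

Section multi_powers.
Context {d : measure_display} {X : measurableType d} {R : realType}.
Context {mu : probability X R}.
Implicit Types S T : invertible_mpt mu.

Lemma measure_preserving_mpt T : measure_preserving mu T.
Proof. by split; [exact: measurable_mpt_fun|exact: mpt_preserving]. Qed.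

Lemma measure_preserving_mpt_inv T : measure_preserving mu (mpt_inv T).
Proof.
split=> [|A mA]; first exact: measurable_mpt_inv.
rewrite -(mpt_preserving T); last first.
  by rewrite -[X in measurable X]setTI; exact: (measurable_mpt_inv T).
by congr (mu _); apply/seteqP; split => x /=; rewrite mpt_funK.
Qed.

Lemma measure_preserving_mpt_pow T n : measure_preserving mu (mpt_pow T n).
Proof.
case: n => n; apply: measure_preserving_iter.
  exact: measure_preserving_mpt.
exact: measure_preserving_mpt_inv.
Qed.

Lemma mpt_powS T (n : int) x : mpt_pow T (n + 1) x = T (mpt_pow T n x).
Proof.
case: n => [n|[|n]]; first by rewrite -PoszD addn1.
- by rewrite /= mpt_invK.
- rewrite (_ : Negz n.+1 + 1 = Negz n); last by rewrite !NegzE; lia.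
  by rewrite [in RHS]/mpt_pow iterS mpt_invK.
Qed.

Lemma mpt_powD T (a b : int) x : mpt_pow T (a + b) x = mpt_pow T a (mpt_pow T b x).
Proof.
have invS n y : mpt_pow T (n - 1) y = mpt_inv T (mpt_pow T n y).
  by rewrite -[in RHS](subrK 1 n) mpt_powS mpt_funK.
elim/int_rect: a => [|n IH|n IH]; first by rewrite add0r.
- rewrite (_ : n.+1%:Z + b = (n%:Z + b) + 1); last by lia.
  by rewrite mpt_powS IH -mpt_powS; congr (mpt_pow T _ _); lia.
- rewrite (_ : - n.+1%:Z + b = (- n%:Z + b) - 1); last by lia.
  by rewrite invS IH -invS; congr (mpt_pow T _ _); lia.
Qed.

Lemma mpt_pow_comm (S : X -> X) T n : S \o T = T \o S ->
  S \o mpt_pow T n = mpt_pow T n \o S.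
Proof.
move=> ST; have ST' x : S (T x) = T (S x) by exact: (congr1 (@^~ x) ST).
have SI x : S (mpt_inv T x) = mpt_inv T (S x).
  by rewrite -[x in RHS](mpt_invK T) ST' mpt_funK.
apply/funext => x /=; case: n => n; rewrite /mpt_pow.
  by elim: n => //= n IH; rewrite ST' IH.
by elim: n.+1 => //= {}n IH; rewrite SI IH.
Qed.

Context {l : nat} (T : 'I_l -> invertible_mpt mu).
Hypothesis TC : forall i j, T i \o T j = T j \o T i.

(** Induction on the coordinates: the power of [T j] with exponent from [b] is moved past the powers
    of the remaining transformations with exponents from [a]. *)
Lemma multi_powD (a b : 'rV[int]_l) :
  multi_pow T (a + b) = multi_pow T a \o multi_pow T b.
Proof.
rewrite /multi_pow; elim: (index_enum 'I_l) => [|j r IH]; first by rewrite !big_nil.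
rewrite !big_cons IH.
have comm :
    mpt_pow (T j) (b ord0 j) \o \big[comp/id]_(i <- r) mpt_pow (T i) (a ord0 i)
    = \big[comp/id]_(i <- r) mpt_pow (T i) (a ord0 i) \o mpt_pow (T j) (b ord0 j).
  elim: r {IH} => [|i r IH]; first by rewrite big_nil.
  rewrite big_cons compA.
  rewrite (_ : mpt_pow (T j) _ \o mpt_pow (T i) _ =
    mpt_pow (T i) (a ord0 i) \o mpt_pow (T j) (b ord0 j)).
    by rewrite -compA IH compA.
  by apply: mpt_pow_comm; apply/esym; apply: mpt_pow_comm.
apply/funext => x /=; rewrite mxE mpt_powD; congr (mpt_pow _ _ _).
exact: (congr1 (@^~ _) comm).
Qed.

Lemma multi_pow0 : multi_pow T 0 = id.
Proof.
rewrite /multi_pow; elim: (index_enum 'I_l) => [|j r IH]; first by rewrite big_nil.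
by rewrite big_cons IH mxE.
Qed.

Lemma measure_preserving_multi_pow c : measure_preserving mu (multi_pow T c).
Proof.
rewrite /multi_pow; elim: (index_enum 'I_l) => [|j r IH].
  by rewrite big_nil; exact: measure_preserving_id.
rewrite big_cons; apply: measure_preserving_comp => //.
exact: measure_preserving_mpt_pow.
Qed.

Definition multi_pow_action : action ('rV[int]_l) (probability_mean_space mu).
Proof.
refine (@Action R 'rV[int]_l (probability_mean_space mu)
  (fun c => multi_pow T c : X -> X) _ _ _ _).
- by move=> x; rewrite multi_pow0.
- by move=> a b x; rewrite multi_powD.
- move=> c f; apply: bounded_measurable_comp.
  exact: measure_preserving_multi_pow.
- move=> c f; apply: Rintegral_measure_preserving.
  exact: measure_preserving_multi_pow.
Defined.

End multi_powers.

(** * L2 limits of uniformly bounded Cauchy sequences *)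

Section l2_completeness.
Context {d : measure_display} {X : measurableType d} {R : realType}.
Context (mu : probability X R).

Local Notation L := (probability_mean_space mu).

(** The argument of Riesz and Fischer: the L1 norms of the steps are summable, so the sum of their
    absolute values is integrable, hence finite almost everywhere. *)
Lemma ae_cvg_of_summable_steps (b : nat -> X -> R) :
  (forall k, bounded_measurable (b k)) ->
  (forall k, mean L (fun x => (b k.+1 x - b k x) ^+ 2) <= (2 ^- k.+1) ^+ 2) ->
  {ae mu, forall x, cvgn (b ^~ x)}.
Proof.
move=> bm b_le.
pose dk k x := `|b k.+1 x - b k x|.
have bd k : bounded_measurable (fun x => b k.+1 x - b k x).
  exact: (algB (X := L) (bm k.+1) (bm k)).
have bd2 k : bounded_measurable (fun x => (b k.+1 x - b k x) ^+ 2).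
  exact: (alg_sqr (X := L) (bd k)).
have md k : measurable_fun [set: X] (dk k).
  by apply: measurableT_comp => //; case: (bd k).
have bdk k : bounded_measurable (dk k).
  split; first exact: md.
  by case: (bd k) => _ [B Bd]; exists B => x; rewrite normr_id.
have dk_le k : mean L (dk k) <= 2 ^- k.+1.
  set t : R := 2 ^- k.+1; have t0 : 0 < t by rewrite invr_gt0 exprn_gt0.
  (* The pointwise inequality [|d| <= d ^+ 2 / (2 * t) + t / 2] replaces Cauchy-Schwarz; each term
     has mean at most [t / 2]. *)
  apply: (@le_trans _ _ (mean L (fun x =>
      (2 * t)^-1 * (b k.+1 x - b k x) ^+ 2 + t / 2))).
    apply: (ler_mean (X := L)) => [||x]; first exact: bdk.
      exact: (algD (algZ (X := L) _ (bd2 k)) (alg_cst L _)).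
    rewrite /dk -[(b _ _ - b _ _) ^+ 2]real_normK ?num_real//.
    rewrite -(ler_pM2l (x := 2 * t)) ?mulr_gt0// mulrDr mulrA divff ?mul1r; last first.
      by rewrite mulf_neq0 ?gt_eqF.
    have := sqr_ge0 (`|b k.+1 x - b k x| - t); nra.
  rewrite (meanD (algZ (X := L) _ (bd2 k)) (alg_cst L _)) (meanZ _ (bd2 k : alg L _)).
  rewrite (mean_cst L) [leRHS]splitr lerD2r -ler_pdivlMl; last first.
    by rewrite invr_gt0 mulr_gt0.
  by rewrite invrK (le_trans (b_le k))// -/t; nra.
have dk0 k x : (0 <= (dk k x)%:E)%E by rewrite lee_fin normr_ge0.
have int_lty : mu.-integrable [set: X] (fun x => \sum_(k <oo) (dk k x)%:E)%E.
  apply/integrableP; split.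
    apply: (@ge0_emeasurable_sum _ _ _ [set: X]
      (fun k x => (dk k x)%:E) xpredT) => //.
    by move=> k _; exact/measurable_EFinP.
  under eq_integral => x _.
    rewrite gee0_abs; last by apply: nneseries_ge0.
    over.
  rewrite integral_nneseries//; last by move=> k; exact/measurable_EFinP.
  apply: (@le_lt_trans _ _ (\sum_(k <oo) (1 / (2 ^ k.+1)%:R)%:E)%E); last first.
    by apply: le_lt_trans (epsilon_trick0 _ _) (ltry 1).
  apply: lee_nneseries => [k _ _|k _]; first by apply: integral_ge0.
  rewrite -[leLHS]fineK; last first.
    exact/integrable_fin_num/bounded_measurable_integrable.
  by rewrite lee_fin natrX div1r; exact: dk_le.
have := integrable_ae measurableT int_lty.
apply: filterS => x /(_ I) sum_fin.
have cdk : cvgn (fun n => \sum_(0 <= k < n) dk k x).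
  apply: nondecreasing_is_cvgn.
    by apply: nondecreasing_series => k _ _; exact: normr_ge0.
  exists (fine (\sum_(k <oo) (dk k x)%:E)%E) => _ [n _ <-].
  by rewrite -lee_fin fineK// -sumEFin; apply: nneseries_lim_ge.
have : cvgn [normed series (fun k => b k.+1 x - b k x)] by exact: cdk.
move=> /normed_cvg; rewrite (_ : series _ = (fun n => b n x - b 0%N x)); last first.
  apply/funext => n; rewrite /series /=.
  by rewrite (telescope_sumr (fun k => b k x)).
move=> cb; rewrite (_ : b ^~ x = (fun n => (b n x - b 0%N x) + b 0%N x)); last first.
  by apply/funext => n; rewrite subrK.
by apply: is_cvgD => //; exact: is_cvg_cst.
Qed.

(** A fast subsequence converges almost everywhere to [h]; dominated convergence then transfers the
    Cauchy bound from [a N] and the subsequence to [a N] and [h]. *)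
Lemma exists_l2_limit (a : nat -> X -> R) (C : R) :
  (forall N, measurable_fun [set: X] (a N)) -> (forall N x, `|a N x| <= C) ->
  l2_cauchy (X := L) a ->
  exists2 h : X -> R, bounded_measurable h & forall e : R, 0 < e ->
    exists N0, forall N, (N0 <= N)%N -> mean L (fun x => (a N x - h x) ^+ 2) <= e.
Proof.
move=> ma aC ca.
have am N : bounded_measurable (a N) by split => //; exists C.
have rate0 k : 0 < (2 ^- k.+1 : R) ^+ 2 by rewrite exprn_gt0// invr_gt0 exprn_gt0.
have [n nP] := choice (fun k : nat => ca _ (rate0 k)).
(* [m k] is at least [k] and at least each of [n 0, ..., n k], so [m k] and [m k.+1] both reach the
   threshold [n k]. *)
pose m k := (k + \sum_(i < k.+1) n i)%N.
have m_ge k : (n k <= m k)%N.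
  by rewrite /m big_ord_recr /= addnA leq_addl.
have m_geS k : (n k <= m k.+1)%N.
  apply: leq_trans (m_ge k) _; rewrite /m (big_ord_recr k.+1)/=.
  by rewrite addSn leqW// addnA leq_addr.
pose b k := a (m k).
have b_cvg : {ae mu, forall x, cvgn (b ^~ x)}.
  by apply: ae_cvg_of_summable_steps => [k|k]; [exact: am|exact: nP].
(* The upper limit is measurable regardless of convergence, and clamping bounds it by [C] also where
   the subsequence diverges. *)
pose h x := Num.max (- C) (Num.min C (limn_sup (b ^~ x))).
have mh : measurable_fun [set: X] h.
  apply: measurable_maxr; first exact: measurable_cst.
  apply: measurable_minr; first exact: measurable_cst.
  apply: measurable_fun_limn_sup => [x _|x _|k]; last exact: ma.
  - by exists C => _ [k _ <-]; have := aC (m k) x; rewrite ler_norml => /andP[].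
  - by exists (- C) => _ [k _ <-]; have := aC (m k) x; rewrite ler_norml => /andP[].
have hC x : `|h x| <= C.
  have C0 : 0 <= C by exact: le_trans (aC 0%N x).
  rewrite /h ler_norml le_max lexx /= ge_max ge_min lexx andbT.
  by rewrite (le_trans _ C0)// oppr_le0.
have bh : {ae mu, forall x, b ^~ x @ \oo --> h x}.
  apply: filterS b_cvg => x /cvg_ex[l bl].
  have [_ lE] := cvg_limn_inf_sup bl.
  suff -> : h x = l by [].
  have lC : `|l| <= C.
    have cnb : (fun k => `|b k x|) @ \oo --> `|l| by exact: cvg_norm.
    rewrite -(cvg_lim _ cnb)//; apply: limr_le; first by apply/cvg_ex; exists `|l|.
    by apply: nearW => k; exact: aC.
  move: lC; rewrite ler_norml => /andP[Cl lC].
  by rewrite /h lE min_r// max_r.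
have hm : bounded_measurable h by split => //; exists C.
exists h => //.
move=> e e0; have [N0 N0P] := ca e e0; exists N0 => N N0N.
have adiff k : bounded_measurable (fun x => (a N x - b k x) ^+ 2).
  exact: (alg_sqr (X := L) (algB (X := L) (am N) (am (m k)))).
have hdiff : bounded_measurable (fun x => (a N x - h x) ^+ 2).
  exact: (alg_sqr (X := L) (algB (X := L) (am N) hm)).
have [] := @dominated_convergence _ _ _ mu [set: X] measurableT
  (fun k x => ((a N x - b k x) ^+ 2)%:E) (fun x => ((a N x - h x) ^+ 2)%:E)
  (cst (((2 * C) ^+ 2)%:E)).
- by move=> k; apply/measurable_EFinP; case: (adiff k).
- by apply/measurable_EFinP; case: hdiff.
- apply: filterS bh => x bhx _; apply: cvg_EFin; first exact: nearW.
  by apply: cvgM; apply: cvgB => //; exact: cvg_cst.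
- apply: bounded_measurable_integrable (fun=> (2 * C) ^+ 2) _.
  split; first exact: measurable_cst.
  by exists `|(2 * C) ^+ 2|.
- apply: aeW => x k _ /=; rewrite lee_fin ger0_norm ?sqr_ge0//.
  have := aC N x; have := aC (m k) x.
  rewrite -/(b k) !ler_norml => /andP[? ?] /andP[? ?].
  have u1 : 0 <= 2 * C - (a N x - b k x) by lra.
  have u2 : 0 <= 2 * C + (a N x - b k x) by lra.
  by have := mulr_ge0 u1 u2; nra.
move=> _ _ int_cvg; rewrite -lee_fin /= /Rintegral fineK; last first.
  exact/integrable_fin_num/bounded_measurable_integrable.
rewrite -(cvg_lim _ int_cvg)//; apply: lime_le.
  by apply/cvg_ex; eexists; exact: int_cvg.
exists N0 => // k /= N0k; rewrite -[leLHS]fineK; last first.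
  exact/integrable_fin_num/bounded_measurable_integrable.
by rewrite lee_fin; apply: N0P => //; apply: leq_trans N0k _; rewrite /m leq_addr.
Qed.

End l2_completeness.

(** * Bounded representatives and the L2 norm *)

Section lp_norms.
Context {d : measure_display} {X : measurableType d} {R : realType}.
Context (mu : probability X R).

(** Truncation at an essential bound changes [f] on a null set only. *)
Lemma Lfun_infty_bounded (f : X -> R) : f \in Lfun mu +oo%E ->
  exists f', bounded_measurable f' /\ {ae mu, forall x, f x = f' x}.
Proof.
move=> /andP[]; rewrite !inE /= => mf; rewrite /finite_norm unlock.
rewrite ifT; last by rewrite /= probability_setT.
move=> /ess_supr_bounded[M fM].
exists (fun x => Num.max (- `|M|) (Num.min `|M| (f x))); split.
  split.
    by apply: measurable_maxr => //; apply: measurable_minr.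
  exists `|M| => x; rewrite ler_norml le_max lexx /= ge_max ge_min lexx andbT.
  by rewrite (le_trans _ (normr_ge0 M))// oppr_le0.
apply: filterS fM => x /= fxM.
have : `|f x| <= `|M| by apply: le_trans fxM (ler_norm _).
by rewrite ler_norml => /andP[Mf fM]; rewrite min_r// max_r.
Qed.

Lemma bounded_measurable_Lnorm2 (f : X -> R) : bounded_measurable f ->
  ('N[mu]_2%:E[EFin \o f])%E = (Num.sqrt (\int[mu]_x (f x ^+ 2)))%:E.
Proof.
move=> fb; rewrite unlock /=.
under eq_integral do rewrite powR_mulrn// real_normK ?num_real//.
have f2 : bounded_measurable (fun x => f x ^+ 2).
  exact: (alg_sqr (X := probability_mean_space mu) fb).
rewrite -[X in (X `^ _)%E]fineK; last first.
  exact/integrable_fin_num/bounded_measurable_integrable.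
by rewrite poweR_EFin -powR12_sqrt// Rintegral_ge0// => x _; exact: sqr_ge0.
Qed.

Lemma bounded_measurable_Lfun2 (f : X -> R) : bounded_measurable f ->
  f \in Lfun mu 2%:E.
Proof.
move=> fb; apply/andP; rewrite !inE /=; split; first by case: fb.
by rewrite /finite_norm bounded_measurable_Lnorm2// ltry.
Qed.

Lemma ae_eq_Lnorm2 (f g : X -> R) :
  measurable_fun [set: X] f -> measurable_fun [set: X] g ->
  {ae mu, forall x, f x = g x} ->
  ('N[mu]_2%:E[EFin \o f] = 'N[mu]_2%:E[EFin \o g])%E.
Proof.
move=> mf mg fg; rewrite unlock /=; congr (_ `^ _)%E.
have mp (k : X -> R) : measurable_fun [set: X] k ->
    measurable_fun [set: X] (fun x => (`|k x| `^ 2)%:E).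
  move=> mk; apply/measurable_EFinP.
  apply: (measurableT_comp (measurable_powR _)) => //.
  exact: measurableT_comp.
apply: ae_eq_integral => //; [exact: mp|exact: mp|].
by apply: filterS fg => x -> _.
Qed.

End lp_norms.

(** * Convergence of the polynomial averages in L2 *)

Theorem theorem1p3 (d : measure_display) (X : measurableType d) (R : realType)
    (mu : probability X R) (l r m : nat) (T : 'I_l -> invertible_mpt mu)
    (hT : totally_ergodic_generating_set T)
    (p : 'I_r -> 'I_l -> 'rV[int]_m -> int)
    (hp : forall (i : 'I_r) (j : 'I_l), integer_polynomial (p i j))
    (f : 'I_r -> X -> R) (hf : forall i : 'I_r, f i \in Lfun mu +oo%E)
    (Phi : nat -> {fset 'rV[int]_m}) (hPhi : folner R Phi) :
  converges_in_L2 mu (fun N : nat => polynomial_average T p f (Phi N)).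
Proof.
have [TC _] := hT.
have PhiF := folner_folner_avg hPhi.
have [f' f'P] := choice (fun i => Lfun_infty_bounded (hf i)).
pose q i u := \row_j p i j u.
have [n nP] := choice (fun i =>
  polyseq_row (fun j => integer_polynomial_polyseq (hp i j))).
pose D := (\max_i n i)%N.
pose s := [seq (q i, f' i) | i <- index_enum 'I_r].
pose TA := multi_pow_action TC.
have sP a : a \in s -> polyseq_lt D a.1 /\ alg (probability_mean_space mu) a.2.
  move=> /mapP[i _ ->]; split; last by case: (f'P i).
  exact: (polyseq_lt_leq (leq_bigmax i) (nP i)).
have avgE N x : polynomial_average T p f' (Phi N) x = sysavg TA (Phi N) s x.
  by apply: eq_avg => u; rewrite /sysprod big_map.
have cauchy := convergent_polyseq PhiF TA sP.
have As a : a \in s -> alg (probability_mean_space mu) a.2 by move=> /sP[].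
have [C C0 sC] := sysprod_bounded TA As.
have mg' N : measurable_fun [set: X] (sysavg TA (Phi N) s).
  by case: (alg_sysavg TA (Phi N) As).
have g'C N x : `|sysavg TA (Phi N) s x| <= C.
  by apply: avg_bound => //; case: PhiF.
have [h hb hlim] := exists_l2_limit mg' g'C cauchy.
exists h; first exact: bounded_measurable_Lfun2.
have [mh _] := hb.
have mg N : measurable_fun [set: X] (polynomial_average T p f (Phi N)).
  apply: measurable_funM => //; apply: measurable_sum => u.
  apply: measurable_prod => i _.
  have /andP[] := hf i; rewrite !inE /= => mfi _.
  by apply: measurableT_comp mfi _; case: (measure_preserving_multi_pow T (q i u)).
have ae_eq N : {ae mu, forall x, polynomial_average T p f (Phi N) x =
                                 sysavg TA (Phi N) s x}.
  (* The exceptional sets are collected over all pairs [(i, c)], which are countably many and are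
     enumerated through [pickle]. *)
  have : {ae mu, forall x, forall k : nat,
      if (choice.unpickle k : option ('I_r * 'rV[int]_l)) is Some (i, c) then
      f i (multi_pow T c x) = f' i (multi_pow T c x) else True}.
    apply: ae_foralln => k; case: (choice.unpickle k) => [[i c]|]; last exact: nearW.
    have [_ fi] := f'P i.
    exact: (measure_preserving_ae (measure_preserving_multi_pow T c) fi).
  apply: filterS => x fx; rewrite -avgE; apply: eq_avg => u.
  apply: eq_bigr => i _.
  by have := fx (choice.pickle (i, (\row_j p i j u)%R)); rewrite choice.pickleK.
rewrite (_ : (fun N => _) = (fun N =>
    (Num.sqrt (\int[mu]_x ((sysavg TA (Phi N) s x - h x) ^+ 2)))%:E)); last first.
  apply/funext => N; rewrite (@ae_eq_Lnorm2 _ _ _ _ _ (sysavg TA (Phi N) s \- h)).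
  - rewrite bounded_measurable_Lnorm2//.
    exact: (algB (X := probability_mean_space mu) (alg_sysavg TA (Phi N) As) hb).
  - exact: measurable_funB.
  - exact: measurable_funB.
  - by apply: filterS (ae_eq N) => x /= ->.
apply/fine_cvgP; split; first exact: nearW.
apply/cvgrPdist_le => e e0; have e20 : 0 < e ^+ 2 by rewrite exprn_gt0.
have [N0 N0P] := hlim _ e20; exists N0 => // N /= /N0P.
rewrite sub0r normrN ger0_norm ?sqrtr_ge0// => /ler_wsqrtr.
by rewrite sqrtr_sqr (ger0_norm (ltW e0)).
Qed.
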